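(* Let $S$ be a semilattice (not assumed to have an identity element). Then the Hochschild cohomology groups $\mathcal{H}^n(\mathcal{A}_S,M)$ are zero for all $n\geq 1$ and all symmetric Banach $\mathcal{A}_S$-bimodules $M$.
   Context: A semilattice is a commutative semigroup in which every element is idempotent ($s^2=s$). For a semigroup $S$, $\mathcal{A}_S=\ell^1(S)$ is the Banach algebra with convolution product, determined by $e_s e_t=e_{st}$, where $e_s$ is the basis vector that is $1$ at $s$ and $0$ elsewhere. A bimodule $M$ over a commutative algebra $A$ is symmetric if $a\cdot x=x\cdot a$ for all $a\in A$, $x\in M$. For a Banach algebra $A$ and Banach $A$-bimodule $M$, let $\mathcal{C}^n(A,M)$ be the Banach space of bounded $n$-linear maps $A^n\to M$ ($n\ge 0$, with $\mathcal{C}^0(A,M)=M$), and define $\delta_n:\mathcal{C}^n(A,M)\to\mathcal{C}^{n+1}(A,M)$ by $$(\delta_nF)(a_1,\dots,a_{n+1})=a_1\cdot F(a_2,\dots,a_{n+1})+\sum_{j=1}^n(-1)^jF(a_1,\dots,a_ja_{j+1},\dots,a_{n+1})+(-1)^{n+1}F(a_1,\dots,a_n)\cdot a_{n+1}.$$ The Hochschild cohomology groups are $\mathcal{H}^n(A,M)=\ker\delta_n/\operatorname{Im}\delta_{n-1}$ (algebraic quotient of vector spaces; $\delta_{-1}=0$). *)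

(* Defs.v *)
From HB Require Import structures.
From mathcomp Require Import all_boot all_order all_algebra.
From mathcomp Require Import all_classical all_reals all_analysis.
From mathcomp Require Import summability.
From mathcomp Require Import complex.
From mathcomp Require Import ring lra zify.
Set Implicit Arguments.
Unset Strict Implicit.
Unset Printing Implicit Defensive.
Import Order.TTheory GRing.Theory Num.Theory.
Import numFieldNormedType.Exports.
Local Open Scope classical_set_scope.
Local Open Scope ring_scope.

Import Normc.

Section ComplexSums.
Variable R : realType.
Implicit Types z : R[i].

Lemma ltC0E (e : R[i]) : 0 < e -> exists2 r : R, 0 < r & e = r%:C%C.
Proof. by case: e => a b; rewrite ltcE/= => /andP[/eqP -> a0]; exists a. Qed.

Lemma normcE_C z : `|z| = (normc z)%:C%C. Proof. by []. Qed.

Lemma normcE_Co (z : R[i]^o) : `|z| = (normc z)%:C%C. Proof. by []. Qed.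

Lemma ltcR' (x y : R) : (x%:C%C < y%:C%C :> R[i]) = (x < y).
Proof. by rewrite ltcR. Qed.

Lemma normc_ge0 z : 0 <= normc z.
Proof. by case: z => a b; rewrite /normc sqrtr_ge0. Qed.

Lemma normcD z z' : normc (z + z') <= normc z + normc z'.
Proof. by rewrite -lecR rmorphD/=; exact: (@ler_normD _ R[i]). Qed.

Lemma normc_N z : normc (- z) = normc z.
Proof. exact: (@normcN R z). Qed.

Lemma normc_Re z : `|complex.Re z| <= normc z.
Proof. by rewrite -lecR; exact: normc_ge_Re. Qed.

Lemma normc_Im z : `|complex.Im z| <= normc z.
Proof.
case: z => a b /=; rewrite -sqrtr_sqr ler_wsqrtr// lerDr; exact: sqr_ge0.
Qed.

Lemma normc_ReIm z : normc z <= `|complex.Re z| + `|complex.Im z|.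
Proof.
case: z => a b /=.
have <- : Num.sqrt ((`|a| + `|b|) ^+ 2) = `|a| + `|b|.
  by rewrite sqrtr_sqr ger0_norm// addr_ge0.
rewrite ler_wsqrtr// sqrrD !real_normK ?num_real// addrAC lerDl.
by rewrite mulrn_wge0// mulr_ge0.
Qed.

Lemma normc_sum (I : Type) (s : seq I) (F : I -> R[i]) :
  normc (\sum_(i <- s) F i) <= \sum_(i <- s) normc (F i).
Proof.
elim: s => [|i s IH]; first by rewrite !big_nil normc0.
by rewrite !big_cons (le_trans (normcD _ _))// lerD2l.
Qed.

Lemma C_complete (F : set_system R[i]^o) : ProperFilter F -> cauchy F -> cvg F.
Proof.
move=> FF /cauchyP cF.
have key (h : R[i] -> R) : (forall z z', `|h z - h z'| <= normc (z - z')) ->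
    cvg (h @ F).
  move=> hL; apply: R_complete; apply: cauchy_exP => e e0.
  have [|x Fx] := cF e%:C%C; first by rewrite ltcR'.
  exists (h x); apply: (@filterS _ F _ (ball x e%:C%C)) Fx => y xy.
  have {}xy : normc ((x : R[i]) - y) < e by rewrite -ltcR'.
  exact: le_lt_trans (hL _ _) xy.
have /cvg_ex[a /cvgrPdist_lt Fa] : cvg (@complex.Re R @ F).
  apply: key => z z'; apply: le_trans (normc_Re _); case: z z' => [? ?] [? ?] //=.
have /cvg_ex[b /cvgrPdist_lt Fb] : cvg (@complex.Im R @ F).
  apply: key => z z'; apply: le_trans (normc_Im _); case: z z' => [? ?] [? ?] //=.
apply/cvg_ex; exists (Complex a b : R[i]^o).
apply/(@cvgrPdist_le _ R[i]^o) => /= e /ltC0E[r r0 ->].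
near=> z; rewrite normcE_Co lecR.
apply: le_trans (normc_ReIm _) _.
rewrite (splitr r) lerD//.
  have : `|a - complex.Re z| < r / 2 by near: z; apply: Fa; rewrite divr_gt0.
  by move/ltW; case: (z).
have : `|b - complex.Im z| < r / 2 by near: z; apply: Fb; rewrite divr_gt0.
by move/ltW; case: (z).
Unshelve. all: by end_near. Qed.

HB.instance Definition _ := Uniform_isComplete.Build R[i]^o C_complete.

End ComplexSums.

Section Sum.
Import finmap.
Variables (R : realType) (T : choiceType).
#[local] Existing Instance totally_filter.
Implicit Types (g : T -> R) (F G : T -> R[i]).
Local Open Scope fset_scope.
Local Open Scope ring_scope.

Lemma esum_geE g (A : {fset T}) : (forall i, 0 <= g i) ->
  ((\sum_(i <- A) g i)%:E <= \esum_(i in [set: T]) (g i)%:E)%E.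
Proof.
move=> g0; rewrite -sumEFin; apply: ereal_sup_ubound.
exists [set` A]; first by split.
by rewrite fsbig_finite//= set_fsetK.
Qed.

Lemma esum_leE g (M : \bar R) :
  (forall A : {fset T}, ((\sum_(i <- A) g i)%:E <= M)%E) ->
  (\esum_(i in [set: T]) (g i)%:E <= M)%E.
Proof.
move=> gM; apply: ge_ereal_sup => _ [X [finX _] <-].
by rewrite fsbig_finite//= sumEFin.
Qed.

(* The l^1-norm as an extended real; [normc z] is [`|z|] as an element of R. *)
Definition l1E F := \esum_(s in [set: T]) (normc (F s))%:E.

Lemma l1E_ge0 F : (0 <= l1E F)%E.
Proof. by apply: esum_ge0 => i _; rewrite lee_fin normc_ge0. Qed.

Lemma l1E_fin F : (l1E F < +oo)%E -> l1E F = (fine (l1E F))%:E.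
Proof. by move=> h; rewrite fineK// ge0_fin_numE// l1E_ge0. Qed.

Lemma partial_sumE F A : partial_sum (F : T -> R[i]^o) A = \sum_(i <- A) F i.
Proof. by rewrite /partial_sum big_seq_fsetE. Qed.

Lemma l1E_tail F : (l1E F < +oo)%E -> forall e : R, 0 < e ->
  exists A : {fset T}, forall B : {fset T}, A `<=` B ->
    normc (\sum_(i <- B) F i - \sum_(i <- A) F i) <= e.
Proof.
move=> Foo e e0.
have : (l1E F - e%:E < l1E F)%E by rewrite (l1E_fin Foo) -EFinB lte_fin ltrBlDr ltrDl.
case/ereal_sup_gt => _ [X [finX _] <-].
rewrite fsbig_finite//= sumEFin => hX; exists (fset_set X) => B XB.
rewrite (big_fsetID _ (mem (fset_set X)) B)/=.
have -> : [fset x | x in B & x \in fset_set X] = fset_set X.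
  apply/fsetP => x; rewrite !inE/=; apply/andP/idP => [[]//|xX].
  by split=> //; exact: (fsubsetP XB).
rewrite addrC addrK; apply: le_trans (normc_sum _ _) _.
have := esum_geE B (fun i => normc_ge0 (F i)).
rewrite (big_fsetID _ (mem (fset_set X)) B)/=.
have -> : [fset x | x in B & x \in fset_set X] = fset_set X.
  apply/fsetP => x; rewrite !inE/=; apply/andP/idP => [[]//|xX].
  by split=> //; exact: (fsubsetP XB).
rewrite -/(l1E F); move: hX; rewrite (l1E_fin Foo) -EFinB lte_fin lee_fin.
by rewrite ltrBlDr => /ltW h1 h2; rewrite -(lerD2l (\sum_(i <- fset_set X) normc (F i))) (le_trans h2).
Qed.

Lemma l1_cvg F : (l1E F < +oo)%E ->
  partial_sum (F : T -> R[i]^o) @ totally --> (sum (F : T -> R[i]^o) : R[i]^o).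
Proof.
move=> Foo.
suff : cvg (partial_sum (F : T -> R[i]^o) @ totally) by [].
apply: C_complete; apply: cauchy_exP => e /ltC0E[r r0 ->].
have [|A hA] := @l1E_tail F Foo (r / 2); first by rewrite divr_gt0.
exists (\sum_(i <- A) F i : R[i]^o); exists A => // B AB.
rewrite /ball/= partial_sumE distrC normcE_Co ltcR'.
by apply: le_lt_trans (hA _ AB) _; rewrite ltr_pdivrMr// ltr_pMr// ltr1n.
Qed.

Lemma sum_unique F (c : R[i]) :
  partial_sum (F : T -> R[i]^o) @ totally --> (c : R[i]^o) ->
  sum (F : T -> R[i]^o) = c.
Proof. by move=> h; apply: cvg_lim h => //; exact: norm_hausdorff. Qed.

Lemma sumD F G : (l1E F < +oo)%E -> (l1E G < +oo)%E ->
  sum (fun i => F i + G i : R[i]^o) = sum (F : T -> R[i]^o) + sum (G : T -> R[i]^o).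
Proof.
move=> Foo Goo; apply: sum_unique.
rewrite [X in X @ _](_ : _ = (partial_sum (F : T -> R[i]^o)) + (partial_sum (G : T -> R[i]^o))).
  by apply: (@cvgD _ R[i]^o); exact: l1_cvg.
by apply/funext => A; rewrite /partial_sum/= big_split.
Qed.

Lemma sumZ (k : R[i]) F : (l1E F < +oo)%E ->
  sum (fun i => k * F i : R[i]^o) = k * sum (F : T -> R[i]^o).
Proof.
move=> Foo; apply: sum_unique.
rewrite [X in X @ _](_ : _ = k \*: (partial_sum (F : T -> R[i]^o))).
  by apply: (@cvgZl_tmp _ R[i]^o); exact: l1_cvg.
by apply/funext => A; rewrite /partial_sum/= [RHS]mulr_sumr.
Qed.

Lemma sum_norm F : ((normc (sum (F : T -> R[i]^o)))%:E <= l1E F)%E.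
Proof.
have [Foo|] := ltP (l1E F) +oo%E; last by rewrite leye_eq => /eqP ->; rewrite leey.
rewrite (l1E_fin Foo) lee_fin; apply/ler_addgt0Pr => e e0.
have /(@cvgrPdist_le _ R[i]^o)/(_ e%:C%C) := l1_cvg Foo.
rewrite ltcR' => /(_ e0)[A _ /(_ A)]; rewrite /= fsubset_refl => /(_ isT).
rewrite partial_sumE normcE_Co lecR => h.
rewrite -[X in normc X](subrK (\sum_(i <- A) F i)).
apply: le_trans (normcD _ _) _; rewrite addrC lerD//.
apply: le_trans (normc_sum _ _) _; rewrite -lee_fin -l1E_fin//.
by apply: esum_geE => i; exact: normc_ge0.
Qed.

Lemma sum_fin F (A : {fset T}) : (forall i, i \notin A -> F i = 0) ->
  sum (F : T -> R[i]^o) = \sum_(i <- A) F i.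
Proof.
move=> FA; apply: sum_unique; apply/(@cvgrPdist_le _ R[i]^o) => e e0.
exists A => // B AB; rewrite partial_sumE.
have -> : \sum_(i <- B) F i = \sum_(i <- A) F i.
  by symmetry; apply: big_fset_incl => // i _ /FA.
by rewrite subrr normr0 ltW.
Qed.

End Sum.

Section L1.
Import finmap.
Local Open Scope ring_scope.
Variables (R : realType) (S : choiceType).

Definition l1_pred : {pred S -> R[i]} := [pred f | (l1E f < +oo)%E].

Lemma l1ED (f g : S -> R[i]) : (l1E (f + g)%R <= l1E f + l1E g)%E.
Proof.
rewrite /l1E -esumD; try by move=> i _; rewrite lee_fin normc_ge0.
by apply: le_esum => i _; rewrite -EFinD lee_fin normcD.
Qed.

Lemma l1EZ_le (k : R[i]) (f : S -> R[i]) : (l1E f < +oo)%E ->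
  (l1E (k *: f)%R <= (normc k * fine (l1E f))%R%:E)%E.
Proof.
move=> foo; apply: esum_leE => A.
rewrite lee_fin (eq_bigr (fun i => normc k * normc (f i))); last first.
  by move=> i _; rewrite -normcM.
rewrite -mulr_sumr ler_wpM2l ?normc_ge0// -lee_fin -l1E_fin//.
by apply: esum_geE => i; exact: normc_ge0.
Qed.

Lemma l1_predZ (k : R[i]) (f : S -> R[i]) : (l1E f < +oo)%E -> (l1E (k *: f)%R < +oo)%E.
Proof. by move=> foo; rewrite (le_lt_trans (l1EZ_le k foo))// ltry. Qed.

Lemma l1E0 : l1E (0 : S -> R[i]) = 0%E.
Proof. by apply: esum1 => i _; rewrite normc0. Qed.

Lemma l1EZ (k : R[i]) (f : S -> R[i]) : (l1E f < +oo)%E ->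
  l1E (k *: f) = (normc k * fine (l1E f))%:E.
Proof.
move=> foo; apply/eqP; rewrite eq_le l1EZ_le//=.
have [->|k0] := eqVneq k 0; first by rewrite scale0r l1E0 normc0 mul0r.
have kfoo := l1_predZ k foo; have := l1EZ_le k^-1 kfoo.
rewrite scalerA mulVf// scale1r (l1E_fin foo) (l1E_fin kfoo) !lee_fin normcV.
rewrite mulrC ler_pdivlMr 1?mulrC// lt_neqAle normc_ge0 andbT eq_sym.
by apply: contra k0 => /eqP/eq0_normc ->.
Qed.

Lemma l1_pred_submod : GRing.submod_closed l1_pred.
Proof.
split=> [|k f g]; rewrite !inE; first by rewrite l1E0.
move=> foo goo; rewrite (le_lt_trans (l1ED _ _))// lte_add_pinfty//.
exact: l1_predZ.
Qed.

HB.instance Definition _ := GRing.isSubmodClosed.Build _ _ l1_pred l1_pred_submod.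

(* S is an arbitrary (possibly uncountable) index set. *)
Record l1 := L1 { l1_val :> S -> R[i]; _ : l1_val \in l1_pred }.

HB.instance Definition _ := [isSub for l1_val].
HB.instance Definition _ := [Choice of l1 by <:].
HB.instance Definition _ := [SubChoice_isSubLmodule of l1 by <:].

Lemma l1P (f : l1) : (l1E f < +oo)%E.
Proof. by have := valP f; rewrite inE. Qed.

Definition l1_norm (f : l1) : R[i] := (fine (l1E f))%:C%C.

Lemma l1E_norm (f : l1) : l1E f = (fine (l1E f))%:E.
Proof. exact: l1E_fin (l1P f). Qed.

Lemma ler_l1_normD f g : l1_norm (f + g) <= l1_norm f + l1_norm g.
Proof.
rewrite -rmorphD/= lecR -lee_fin EFinD -!l1E_norm.
exact: l1ED.
Qed.

Lemma l1_normZ (k : R[i]) f : l1_norm (k *: f) = `|k| * l1_norm f.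
Proof.
by rewrite normcE_C -rmorphM/=; congr (_%:C)%C; rewrite /= l1EZ ?l1P.
Qed.

Lemma l1_norm0_eq0 f : l1_norm f = 0 -> f = 0.
Proof.
move=> /(congr1 (@complex.Re R))/= f0; apply/val_inj/funext => s /=.
apply: eq0_normc; apply/eqP; rewrite eq_le normc_ge0 andbT -lee_fin -f0 -l1E_norm.
have := @esum_geE R S (fun i => normc (f i)) (fset1 s) (fun i => normc_ge0 (f i)).
by rewrite big_seq_fset1.
Qed.

HB.instance Definition _ := @Lmodule_isNormed.Build R[i] l1 l1_norm
  ler_l1_normD l1_normZ l1_norm0_eq0.

Lemma l1_normE (f : l1) : `|f| = (fine (l1E f))%:C%C. Proof. by []. Qed.

Lemma l1_coord (f : l1) s : normc (f s) <= fine (l1E f).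
Proof.
rewrite -lee_fin -l1E_norm.
have := @esum_geE R S (fun i => normc (f i)) (fset1 s) (fun i => normc_ge0 (f i)).
by rewrite big_seq_fset1.
Qed.

Lemma l1_complete (F : set_system l1) : ProperFilter F -> cauchy F -> cvg F.
Proof.
move=> FF /cauchyP cF.
have cs s : cvg ((fun f : l1 => f s : R[i]^o) @ F).
  apply: C_complete; apply: cauchy_exP => e e0.
  have [x Fx] := cF e e0; exists (x s : R[i]^o).
  apply: (@filterS _ F _ (ball x e)) Fx => y.
  rewrite -ball_normE /ball_/= => xy.
  apply: le_lt_trans xy; have := l1_coord (x - y) s.
  by rewrite -lecR.
pose L s : R[i]^o := lim ((fun f : l1 => f s : R[i]^o) @ F).
have key (e : R) (x : l1) : 0 < e -> F (ball x e%:C%C) ->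
    (l1E (L - (x : S -> R[i]))%R <= e%:E)%E.
  move=> e0 Fx; apply: esum_leE => A; rewrite lee_fin.
  apply/ler_addgt0Pr => d d0.
  pose N := (size (enum_fset A)).+1.
  have dN0 : 0 < d / N%:R by rewrite divr_gt0// ltr0n.
  near F => f.
  have fL s : s \in A -> normc (L s - f s) <= d / N%:R.
    move: s; near: f.
    apply: filterS (@filter_bigI _ _ A (fun s => [set f : l1 | normc (L s - f s) <= d / N%:R]) F _ _).
      by move=> f fA s sA; exact: (fA s sA).
    move=> s _; have /(@cvgrPdist_le _ R[i]^o)/(_ (d / N%:R)%:C%C) := cs s.
    by rewrite ltcR' => /(_ dN0); apply: filterS => f; rewrite normcE_Co lecR.
  have xf : fine (l1E (x - f)) < e.
    have : ball x e%:C%C f by near: f.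
    by rewrite -ball_normE /ball_/= l1_normE ltcR'.
  apply: (@le_trans _ _ (\sum_(s <- A) (d / N%:R + normc ((x - f) s)))).
    apply: (@le_trans _ _ (\sum_(s <- A | s \in A) (d / N%:R + normc ((x - f) s)))).
      rewrite big_seq; apply: ler_sum => s sA.
      have -> : (L - (x : S -> R[i])) s = (L s - f s) - (x - f) s.
        by rewrite /= opprB addrA subrK.
      apply: le_trans (normcD _ _) _.
      by rewrite normc_N lerD2r fL.
    by rewrite -big_seq.
  rewrite big_split/= addrC lerD//.
    apply: le_trans (ltW xf); rewrite -lee_fin -l1E_norm.
    by apply: esum_geE => i; exact: normc_ge0.
  rewrite big_const_seq count_predT iter_addr_0 -[leLHS]mulr_natr.
  rewrite mulrAC ler_pdivrMr ?ltr0n// ler_pM2l// ler_nat /N.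
  exact: leqnSn.
have Lpred : (L : S -> R[i]) \in l1_pred.
  have [|x Fx] := cF 1%:C%C; first by rewrite ltcR'.
  rewrite inE -(subrK (x : S -> R[i]) L) (le_lt_trans (l1ED _ _))//.
  by rewrite lte_add_pinfty ?l1P// (le_lt_trans (key _ _ _ Fx)) ?ltry.
apply/cvg_ex; exists (L1 Lpred); apply/cvgrPdist_le => e /ltC0E[r r0 ->].
have r20 : 0 < r / 2 by rewrite divr_gt0.
have [|x Fx] := cF (r / 2)%:C%C; first by rewrite ltcR'.
have := key _ _ r20 Fx => Lx.
apply: (@filterS _ F _ (ball x (r / 2)%:C%C)) Fx => f.
rewrite -ball_normE /ball_/= l1_normE ltcR' => xf.
rewrite l1_normE lecR -lee_fin -l1E_norm.
have -> : (L1 Lpred - f : l1) = (L1 Lpred - x) + (x - f) by rewrite addrA subrK.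
apply: (le_trans (l1ED (L1 Lpred - x) (x - f))).
rewrite (splitr r) EFinD leeD// l1E_norm lee_fin.
exact: ltW.
Unshelve. all: by end_near. Qed.

HB.instance Definition _ := Uniform_isComplete.Build l1 l1_complete.
End L1.

(* No unit is assumed: l^1(S) has one only in special cases. *)
HB.mixin Record CompleteNormedModule_isBanachAlgebra (K : numFieldType) A
    & CompleteNormedModule K A := {
  bmul : A -> A -> A;
  bmulA : associative bmul;
  bmulDl : left_distributive bmul +%R;
  bmulDr : right_distributive bmul +%R;
  bmulZl : forall (k : K) (a b : A), bmul (k *: a) b = k *: bmul a b;
  bmulZr : forall (k : K) (a b : A), bmul a (k *: b) = k *: bmul a b;
  ler_norm_bmul : forall a b : A, `|bmul a b| <= `|a| * `|b|
}.

#[short(type="banachAlgType")]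
HB.structure Definition BanachAlgebra (K : numFieldType) :=
  {A of CompleteNormedModule K A & CompleteNormedModule_isBanachAlgebra K A}.

Notation "a ** b" := (bmul a b) (at level 40, left associativity) : ring_scope.

Section L1Density.
Import finmap.
Local Open Scope ring_scope.
Variables (R : realType) (S : choiceType).
Local Notation l1 := (l1 R S).

Lemma l1_dirac_subproof (s : S) : (fun t => (t == s)%:R : R[i]) \in @l1_pred R S.
Proof.
rewrite inE; apply: (@le_lt_trans _ _ 1%:E); last exact: ltry.
apply: esum_leE => A; rewrite lee_fin.
have [sA|sA] := boolP (s \in A).
  rewrite (big_fsetD1 s)//= eqxx normc1 big_seq big1 ?addr0// => i.
  by rewrite !inE => /andP[/negPf -> _]; rewrite normc0.
rewrite big_seq big1// => i iA; case: eqP => [E|_]; last by rewrite normc0.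
by rewrite -E iA in sA.
Qed.

Definition l1_dirac (s : S) : l1 := L1 (l1_dirac_subproof s).

Lemma l1_sumE (A : {fset S}) (F : S -> l1) (t : S) :
  (\sum_(s <- A) F s : l1) t = \sum_(s <- A) F s t.
Proof.
elim/big_ind2 : _ => [||//]; first by [].
by move=> x1 x2 y1 y2 <- <-.
Qed.

Lemma l1_scale_diracE (k : R[i]) s t : (k *: l1_dirac s) t = k * (t == s)%:R.
Proof. by []. Qed.

Lemma l1_approx (f : l1) (e : R) : 0 < e ->
  exists A : {fset S}, `|f - \sum_(s <- A) f s *: l1_dirac s| <= e%:C%C.
Proof.
move=> e0.
have : (l1E f - e%:E < l1E f)%E by rewrite l1E_norm -EFinB lte_fin ltrBlDr ltrDl.
case/ereal_sup_gt => _ [X [finX _] <-].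
rewrite fsbig_finite//= sumEFin => hX; exists (fset_set X); set A := fset_set X.
set g : l1 := f - \sum_(s <- A) f s *: l1_dirac s.
have fE t : g t = if t \in A then 0 else f t.
  transitivity (f t - (\sum_(s <- A) f s *: l1_dirac s : l1) t); first by [].
  rewrite l1_sumE; under eq_bigr do rewrite l1_scale_diracE.
  case: ifPn => tA.
    rewrite (big_fsetD1 t)//= eqxx big_seq big1 => [|i].
      by rewrite addr0 mulr1 subrr.
    rewrite !inE => /andP[it _]; by rewrite eq_sym (negPf it) mulr0.
  rewrite big_seq big1 ?subr0// => i iA.
  case: eqP => [E|_]; last by rewrite mulr0.
  by rewrite E iA in tA.
clearbody g.
rewrite l1_normE lecR -lee_fin -l1E_norm; apply: esum_leE => B; rewrite lee_fin.
have := esum_geE (A `|` B)%fset (fun i => normc_ge0 (f i)).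
rewrite -/(l1E f) l1E_norm lee_fin => hAB.
have : \sum_(i <- A) normc (f i) +
    \sum_(i <- B) normc (g i) <= fine (l1E f).
  apply: le_trans hAB; rewrite (big_fsetID _ (mem A) (A `|` B)%fset)/=.
  rewrite (_ : [fset x | x in _ & _]%fset = A); last first.
    by apply/fsetP => x; rewrite !inE/=; case: (x \in A); rewrite ?andbF.
  rewrite lerD2l (_ : [fset x | x in _ & _]%fset = (B `\` A)%fset); last first.
    by apply/fsetP => x; rewrite !inE/=; case: (x \in A); rewrite ?andbF ?andbT.
  rewrite (big_fsetID _ (mem A) B)/= [X in X + _]big_seq [X in X + _]big1; last first.
    by move=> i; rewrite !inE/= => /andP[_ iA]; rewrite fE iA normc0.
  rewrite add0r (_ : [fset x | x in _ & _]%fset = (B `\` A)%fset); last first.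
    by apply/fsetP => x; rewrite !inE/= andbC.
  rewrite big_seq [leRHS]big_seq; apply: ler_sum => i; rewrite !inE => /andP[iA _].
  by rewrite fE (negPf iA).
move: hX; rewrite l1E_norm -EFinB lte_fin ltrBlDr => h1 h2.
by rewrite -(lerD2l (\sum_(i <- A) normc (f i))) (le_trans h2)// ltW.
Qed.

Lemma l1_ext (V : normedModType R[i]) (phi : l1 -> V) (M : R) : linear phi ->
  (forall f, `|phi f| <= M%:C%C * `|f|) -> (forall s, phi (l1_dirac s) = 0) ->
  forall f, phi f = 0.
Proof.
move=> lphi bphi phi0 f.
pose lp := GRing.isLinear.Build _ _ _ _ phi lphi.
pose phil : {linear l1 -> V} := HB.pack phi lp.
have M1 : 0 < `|M| + 1 by rewrite ltr_wpDl.
apply/eqP; rewrite -normr_le0; apply/ler_addgt0Pr => _ /ltC0E[e e0 ->].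
rewrite add0r; have [|A fA] := @l1_approx f (e / (`|M| + 1)); first by rewrite divr_gt0.
have -> : phi f = phi (f - \sum_(s <- A) f s *: l1_dirac s).
  rewrite -[phi]/(phil : _ -> _) linearB linear_sum big1 ?subr0// => s _.
  by rewrite linearZ/= phi0 scaler0.
apply: le_trans (bphi _) _.
have MM : M%:C%C <= (`|M| + 1)%:C%C :> R[i].
  by rewrite lecR (le_trans (ler_norm _))// lerDl.
apply: le_trans (ler_wpM2r _ MM) _ => //.
have M1C : 0 < (`|M| + 1)%:C%C :> R[i] by rewrite ltcR'.
apply: le_trans (ler_wpM2l (ltW M1C) fA) _.
by rewrite -rmorphM/= mulrCA divff ?mulr1// gt_eqF.
Qed.

End L1Density.

Section Convolution.
Import finmap.
Local Open Scope ring_scope.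
Variables (R : realType) (S : semigroupType).
Local Notation l1 := (l1 R S).
Implicit Types f g h : l1.

(* (f * g)(u) is the sum of f(s) g(t) over all pairs (s, t) with s t = u: the
   limit of the partial sums along the finite subsets of S * S. *)
Definition conv_term f g (u : S) (p : S * S) : R[i] :=
  if (p.1 * p.2)%g == u then f p.1 * g p.2 else 0.

Definition conv f g (u : S) : R[i] := sum (conv_term f g u : S * S -> R[i]^o).

Lemma l1E_tensor f g :
  l1E (fun p : S * S => f p.1 * g p.2) = (fine (l1E f) * fine (l1E g))%:E.
Proof.
rewrite /l1E.
rewrite [LHS](_ : _ = \esum_(s in [set: S]) \esum_(t in [set: S]) (normc (f s * g t))%:E); last first.
  rewrite (@esum_esum _ _ _ _ (fun _ => setT) (fun s t => (normc (f s * g t))%:E)).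
    by congr (esum _ _); apply/seteqP; split.
  by move=> i j _ _; rewrite lee_fin normc_ge0.
rewrite [LHS](_ : _ = \esum_(s in [set: S]) (normc ((fine (l1E g))%:C%C * f s))%:E); last first.
  apply: eq_esum => s _; rewrite -/(l1E (f s *: (g : S -> R[i]))).
  rewrite l1EZ ?l1P// mulrC normcM; congr (_ * _)%:E.
  rewrite /normc /= expr0n/= addr0 sqrtr_sqr ger0_norm//.
  by apply: fine_ge0; exact: l1E_ge0.
rewrite -/(l1E ((fine (l1E g))%:C%C *: (f : S -> R[i]))) l1EZ ?l1P// mulrC.
rewrite /normc /= expr0n/= addr0 sqrtr_sqr ger0_norm//.
by apply: fine_ge0; exact: l1E_ge0.
Qed.

Lemma conv_term_fin f g u : (l1E (conv_term f g u) < +oo)%E.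
Proof.
apply: (@le_lt_trans _ _ (l1E (fun p : S * S => f p.1 * g p.2))).
  apply: le_esum => p _; rewrite lee_fin /conv_term; case: ifP => // _.
  by rewrite normc0 normc_ge0.
by rewrite l1E_tensor ltry.
Qed.

Lemma l1E_conv f g : (l1E (conv f g) <= (fine (l1E f) * fine (l1E g))%:E)%E.
Proof.
rewrite -l1E_tensor; apply: esum_leE => A; rewrite -sumEFin.
apply: (@le_trans _ _ (\sum_(u <- A) l1E (conv_term f g u))%E).
  by apply: lee_sum => u _; exact: sum_norm.
rewrite /l1E -esum_sum; last by move=> *; rewrite lee_fin normc_ge0.
apply: le_esum => p _; rewrite sumEFin lee_fin /conv_term.
have [pA|pA] := boolP ((p.1 * p.2)%g \in A).
  rewrite (big_fsetD1 _ pA)/= eqxx big_seq big1 ?addr0// => u.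
  by rewrite !inE eq_sym => /andP[/negPf -> _]; rewrite normc0.
rewrite big_seq big1 ?normc_ge0// => u uA; case: eqP => [E|_]; last by rewrite normc0.
by rewrite E uA in pA.
Qed.

Lemma conv_subproof f g : conv f g \in @l1_pred R S.
Proof. by rewrite inE (le_lt_trans (l1E_conv f g))// ltry. Qed.

Definition l1_mul f g : l1 := L1 (conv_subproof f g).

Lemma l1_mulDl : left_distributive l1_mul +%R.
Proof.
move=> f g h; apply/val_inj/funext => u /=.
transitivity (conv f h u + conv g h u); last by [].
rewrite /conv -sumD; try exact: conv_term_fin.
apply: (congr1 (fun F : S * S -> R[i] => sum (F : S * S -> R[i]^o))); apply/funext => p; rewrite /conv_term.
by case: ifP => _; rewrite ?addr0// -mulrDl.
Qed.

Lemma l1_mulDr : right_distributive l1_mul +%R.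
Proof.
move=> f g h; apply/val_inj/funext => u /=.
transitivity (conv f g u + conv f h u); last by [].
rewrite /conv -sumD; try exact: conv_term_fin.
apply: (congr1 (fun F : S * S -> R[i] => sum (F : S * S -> R[i]^o))); apply/funext => p; rewrite /conv_term.
by case: ifP => _; rewrite ?addr0// -mulrDr.
Qed.

Lemma l1_mulZl (k : R[i]) f g : l1_mul (k *: f) g = k *: l1_mul f g.
Proof.
apply/val_inj/funext => u /=; transitivity (k * conv f g u); last by [].
rewrite /conv -sumZ; last exact: conv_term_fin.
apply: (congr1 (fun F : S * S -> R[i] => sum (F : S * S -> R[i]^o))); apply/funext => p; rewrite /conv_term.
by case: ifP => _; rewrite ?mulr0// mulrA.
Qed.

Lemma l1_mulZr (k : R[i]) f g : l1_mul f (k *: g) = k *: l1_mul f g.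
Proof.
apply/val_inj/funext => u /=; transitivity (k * conv f g u); last by [].
rewrite /conv -sumZ; last exact: conv_term_fin.
apply: (congr1 (fun F : S * S -> R[i] => sum (F : S * S -> R[i]^o))); apply/funext => p; rewrite /conv_term.
by case: ifP => _; rewrite ?mulr0// mulrCA.
Qed.

Lemma ler_norm_l1_mul f g : `|l1_mul f g| <= `|f| * `|g|.
Proof.
by rewrite !l1_normE -rmorphM/= lecR -lee_fin -(l1E_norm (l1_mul f g)) l1E_conv.
Qed.

Lemma l1_mul_dirac s t : l1_mul (l1_dirac R s) (l1_dirac R t) = l1_dirac R (s * t)%g.
Proof.
apply/val_inj/funext => u /=; rewrite /conv (@sum_fin _ _ _ [fset (s, t)]%fset).
  rewrite big_seq_fset1 /conv_term/= !eqxx mulr1 eq_sym.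
  by case: eqP.
move=> [a b]; rewrite !inE xpair_eqE negb_and /conv_term /= => /orP[|] /negPf ->.
  by rewrite mul0r if_same.
by rewrite mulr0 if_same.
Qed.

Lemma l1_mulA : associative l1_mul.
Proof.
pose D f g h := l1_mul f (l1_mul g h) - l1_mul (l1_mul f g) h.
have nD f g h : `|D f g h| <= 2%:R * (`|f| * `|g| * `|h|).
  rewrite mulr_natl mulr2n; apply: le_trans (ler_normB _ _) _; apply: lerD.
    apply: le_trans (ler_norm_l1_mul _ _) _; rewrite -mulrA ler_wpM2l//.
    exact: ler_norm_l1_mul.
  apply: le_trans (ler_norm_l1_mul _ _) _; rewrite ler_wpM2r//.
  exact: ler_norm_l1_mul.
suff D0 f g h : D f g h = 0 by move=> f g h; apply/eqP; rewrite -subr_eq0 [X in X == _]D0.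
have nC (c : R[i]) : 0 <= c -> exists r : R, c = r%:C%C.
  by move=> /ger0_real/complex_realP.
have [rg Eg] := nC `|g| (normr_ge0 _).
have [rh Eh] := nC `|h| (normr_ge0 _).
have E2 : 2%:R = 2%:R%:C%C :> R[i] by rewrite rmorph_nat.
apply: (@l1_ext _ _ _ (fun f => D f g h) (2%:R * rg * rh)).
- move=> k a b; rewrite /D !(l1_mulDl, l1_mulZl, l1_mulDr, l1_mulZr).
  by rewrite scalerBr opprD addrACA.
- move=> a; apply: le_trans (nD _ _ _) _; rewrite Eg Eh !rmorphM/= -E2.
  by rewrite le_eqVlt; apply/orP; left; apply/eqP; ring.
move=> s; have [rs Es] := nC `|l1_dirac R s| (normr_ge0 _).
apply: (@l1_ext _ _ _ (fun g => D _ g h) (2%:R * rs * rh)).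
- move=> k a b; rewrite /D !(l1_mulDl, l1_mulZl, l1_mulDr, l1_mulZr).
  by rewrite scalerBr opprD addrACA.
- move=> a; apply: le_trans (nD _ _ _) _; rewrite Es Eh !rmorphM/= -E2.
  by rewrite le_eqVlt; apply/orP; left; apply/eqP; ring.
move=> t; have [rt Et] := nC `|l1_dirac R t| (normr_ge0 _).
apply: (@l1_ext _ _ _ (fun h => D _ _ h) (2%:R * rs * rt)).
- move=> k a b; rewrite /D !(l1_mulDl, l1_mulZl, l1_mulDr, l1_mulZr).
  by rewrite scalerBr opprD addrACA.
- move=> a; apply: le_trans (nD _ _ _) _; rewrite Es Et !rmorphM/= -E2.
  by rewrite le_eqVlt; apply/orP; left; apply/eqP; ring.
by move=> u; rewrite /D !l1_mul_dirac mulgA subrr.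
Qed.

HB.instance Definition _ := CompleteNormedModule_isBanachAlgebra.Build R[i] l1
  l1_mulA l1_mulDl l1_mulDr l1_mulZl l1_mulZr ler_norm_l1_mul.

End Convolution.

(* The actions are jointly continuous (not necessarily contractive); linearity
   over K in each argument is part of the axioms. *)
HB.mixin Record CompleteNormedModule_isBanachBimodule (K : numFieldType)
    (A : banachAlgType K) M & CompleteNormedModule K M := {
  lact : A -> M -> M;
  ract : M -> A -> M;
  lact_linearl : forall x : M, linear (fun a => lact a x);
  lact_linearr : forall a : A, linear (lact a);
  ract_linearl : forall a : A, linear (fun x => ract x a);
  ract_linearr : forall x : M, linear (ract x);
  lactA : forall (a b : A) (x : M), lact a (lact b x) = lact (a ** b) x;
  ractA : forall (x : M) (a b : A), ract (ract x a) b = ract x (a ** b);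
  lractA : forall (a : A) (x : M) (b : A), ract (lact a x) b = lact a (ract x b);
  lact_bounded : exists C : K, forall a x, `|lact a x| <= C * `|a| * `|x|;
  ract_bounded : exists C : K, forall x a, `|ract x a| <= C * `|x| * `|a|
}.

#[short(type="banachBimodType")]
HB.structure Definition BanachBimodule (K : numFieldType) (A : banachAlgType K) :=
  {M of CompleteNormedModule K M & CompleteNormedModule_isBanachBimodule K A M}.

Definition symmetric_bimod (K : numFieldType) (A : banachAlgType K)
    (M : banachBimodType A) : Prop :=
  forall (a : A) (x : M), lact a x = ract x a.

Section Hochschild.
Variables (K : numFieldType) (A : banachAlgType K) (M : banachBimodType A).

Section Cochain.
Variable n : nat.
Implicit Types F G : ('I_n -> A) -> M.

Definition multilinear F : Prop :=
  forall (a : 'I_n -> A) (i : 'I_n), linear (fun x : A => F (dfwith a i x)).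

Definition mbounded F : Prop :=
  exists C : K, forall a : 'I_n -> A, `|F a| <= C * \prod_(i < n) `|a i|.

Definition cochain_pred : {pred ('I_n -> A) -> M} :=
  [pred F | `[< multilinear F /\ mbounded F >]].

Lemma multilinearP F : multilinear F <->
  forall (i : 'I_n) (k : K) (a b c : 'I_n -> A),
    (forall j, j != i -> c j = a j) -> (forall j, j != i -> c j = b j) ->
    c i = k *: a i + b i -> F c = k *: F a + F b.
Proof.
split=> [mF i k a b c ca cb ci|mF a i k x y].
  have dE (d : 'I_n -> A) : (forall j, j != i -> c j = d j) ->
      dfwith c i (d i) = d.
    move=> cd; apply/funext => j; have [->|ji] := eqVneq j i.
      by rewrite dfwithin.
    by rewrite dfwithout 1?eq_sym// cd.
  have := mF c i k (a i) (b i); rewrite /= (dE _ ca) (dE _ cb) -ci.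
  by rewrite dE.
apply: (mF i); rewrite ?dfwithin// => j ji; rewrite !dfwithout// eq_sym//.
Qed.

Lemma mbounded_norm F (C : K) : (forall a, `|F a| <= C * \prod_(i < n) `|a i|) ->
  forall a, `|F a| <= `|C| * \prod_(i < n) `|a i|.
Proof.
move=> FC a; have h := FC a.
rewrite -[X in _ <= _ * X]ger0_norm ?prodr_ge0// -normrM ger0_norm//.
exact: le_trans h.
Qed.

Lemma cochain_predP F :
  reflect (multilinear F /\ mbounded F) (F \in cochain_pred).
Proof. exact: asboolP. Qed.

Lemma cochain_submod : GRing.submod_closed cochain_pred.
Proof.
split=> [|k F G].
  apply/cochain_predP; split=> [a i k x y|]; first by rewrite scaler0 addr0.
  by exists 0 => a; rewrite normr0 mul0r.
move=> /cochain_predP[mF [C1 bF]] /cochain_predP[mG [C2 bG]].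
apply/cochain_predP; split.
  move=> a i l x y; have /= EF := mF a i l x y; have /= EG := mG a i l x y.
  change (k *: F (dfwith a i (l *: x + y)) + G (dfwith a i (l *: x + y)) =
    l *: (k *: F (dfwith a i x) + G (dfwith a i x)) +
      (k *: F (dfwith a i y) + G (dfwith a i y))).
  rewrite EF EG.
  by rewrite !scalerDr !scalerA mulrC addrACA.
exists (`|k| * C1 + C2) => a; apply: le_trans (ler_normD _ _) _.
by rewrite mulrDl lerD// normrZ -mulrA ler_wpM2l.
Qed.

HB.instance Definition _ :=
  GRing.isSubmodClosed.Build _ _ cochain_pred cochain_submod.

(* For n = 0 there is a single map 'I_0 -> A, so that a 0-cochain amounts to an
   element of M. *)
Record cochain := Cochain { cochain_val :> ('I_n -> A) -> M;
                            _ : cochain_val \in cochain_pred }.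

HB.instance Definition _ := [isSub for cochain_val].
HB.instance Definition _ := [Choice of cochain by <:].
HB.instance Definition _ := [SubChoice_isSubLmodule of cochain by <:].

Lemma cochainP (F : cochain) : multilinear F /\ mbounded F.
Proof. exact/cochain_predP/(valP F). Qed.

End Cochain.

Section Coboundary.
Variable n : nat.
Implicit Types (F : ('I_n -> A) -> M) (a : 'I_n.+1 -> A).

Definition args_tail a : 'I_n -> A := fun i => a (lift ord0 i).
Definition args_init a : 'I_n -> A := fun i => a (widen_ord (leqnSn n) i).
Definition args_merge (j : 'I_n) a : 'I_n -> A := fun i =>
  if (i < j)%N then a (widen_ord (leqnSn n) i)
  else if i == j then a (widen_ord (leqnSn n) j) ** a (lift ord0 j)
  else a (lift ord0 i).

(* Arguments are numbered from 0: [args_merge j] multiplies the arguments j and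
   j + 1, which carries the sign (-1)^(j + 1). *)
Definition coboundary_fun F a : M :=
  lact (a ord0) (F (args_tail a))
  + \sum_(j < n) (-1) ^+ j.+1 *: F (args_merge j a)
  + (-1) ^+ n.+1 *: ract (F (args_init a)) (a ord_max).

Lemma ord_case (i : 'I_n.+1) (j : 'I_n) :
  (exists2 p : 'I_n, (p <= j)%N & i = widen_ord (leqnSn n) p) \/
  (exists2 p : 'I_n, (j <= p)%N & i = lift ord0 p).
Proof.
have [ij|ji] := leqP i j.
  left; exists (Ordinal (leq_ltn_trans ij (ltn_ord j))) => //.
  exact/val_inj.
right; have i1 : (i.-1 < n)%N by have := ltn_ord i; lia.
exists (Ordinal i1) => /=; first by lia.
apply/val_inj; rewrite /= /bump leq0n; lia.
Qed.

Lemma widen_neq_lift (j : 'I_n) : lift ord0 j != widen_ord (leqnSn n) j.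
Proof. by rewrite -val_eqE/= /bump; lia. Qed.

Lemma args_merge_off (j p : 'I_n) (i : 'I_n.+1) a c :
  (forall l, l != i -> c l = a l) ->
  (p <= j)%N /\ i = widen_ord (leqnSn n) p \/ (j <= p)%N /\ i = lift ord0 p ->
  forall q, q != p -> args_merge j c q = args_merge j a q.
Proof.
move=> ca ip q qp.
have {}qp : nat_of_ord q <> p by move=> /val_inj /eqP; rewrite (negPf qp).
rewrite /args_merge; case: (ltngtP q j) => /= [qj|qj|/val_inj qj].
- by case: ip => -[pj ip]; rewrite ca// ip -val_eqE/= ?/bump; lia.
- have -> : (q == j) = false by rewrite -val_eqE/=; lia.
  by case: ip => -[pj ip]; rewrite ca// ip -val_eqE/= ?/bump; lia.
- subst q; rewrite eqxx.
  by case: ip => -[pj ip]; rewrite !ca// ip -val_eqE/= ?/bump; lia.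
Qed.

Lemma multilinear_merge F (j : 'I_n) : multilinear F ->
  multilinear (fun a : 'I_n.+1 -> A => F (args_merge j a)).
Proof.
move=> /multilinearP mF; apply/multilinearP => i k a b c ca cb ci.
have [p ip] : exists p : 'I_n, (p <= j)%N /\ i = widen_ord (leqnSn n) p \/
    (j <= p)%N /\ i = lift ord0 p.
  by case: (ord_case i j) => -[p pj ip]; exists p; [left|right].
apply: (mF p).
- exact: args_merge_off ca ip.
- exact: args_merge_off cb ip.
rewrite /args_merge; case: (ltngtP p j) => /= [pj|pj|/val_inj pj].
- by case: ip => -[jp ip]; [rewrite -ip|lia].
- have -> : (p == j) = false by rewrite -val_eqE/=; lia.
  by case: ip => -[jp ip]; [lia|rewrite -ip].
- subst p; rewrite eqxx; case: ip => -[_ ip].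
    have li : lift ord0 j != i by rewrite ip widen_neq_lift.
    by rewrite -ip ci -(ca _ li) -(cb _ li) bmulDl bmulZl.
  have wi : widen_ord (leqnSn n) j != i by rewrite ip eq_sym widen_neq_lift.
  by rewrite -ip ci -(ca _ wi) -(cb _ wi) bmulDr bmulZr.
Qed.

Lemma multilinear_tail F : multilinear F ->
  multilinear (fun a : 'I_n.+1 -> A => lact (a ord0) (F (args_tail a))).
Proof.
move=> /multilinearP mF; apply/multilinearP => i k a b c ca cb ci.
case: (unliftP ord0 i) => [p|] ip.
  rewrite -(ca ord0) ?ip// -(cb ord0) ?ip// -(lact_linearr (c ord0)).
  congr lact; apply: (mF p); rewrite /args_tail -?ip//.
    by move=> q qp; rewrite ca// ip (inj_eq lift_inj).
  by move=> q qp; rewrite cb// ip (inj_eq lift_inj).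
have ta : args_tail c = args_tail a.
  by apply/funext => q; rewrite /args_tail ca ?ip.
have tb : args_tail c = args_tail b.
  by apply/funext => q; rewrite /args_tail cb ?ip.
rewrite -ta -tb -ip ci; exact: (lact_linearl (F (args_tail c))).
Qed.

Lemma widen_neq_max (q : 'I_n) : widen_ord (leqnSn n) q != ord_max.
Proof. by rewrite -val_eqE/= ltn_eqF. Qed.

Lemma multilinear_init F : multilinear F ->
  multilinear (fun a : 'I_n.+1 -> A => ract (F (args_init a)) (a ord_max)).
Proof.
move=> /multilinearP mF; apply/multilinearP => i k a b c ca cb ci.
have [ip|ip] := eqVneq i ord_max.
  have ta : args_init c = args_init a.
    by apply/funext => q; rewrite /args_init ca ?ip ?widen_neq_max.
  have tb : args_init c = args_init b.
    by apply/funext => q; rewrite /args_init cb ?ip ?widen_neq_max.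
  rewrite -ta -tb -ip ci; exact: (ract_linearr (F (args_init c))).
have [p {}ip] : exists p, i = widen_ord (leqnSn n) p.
  have i_n : (i < n)%N.
    by move: ip; rewrite -val_eqE/= => ip; have := ltn_ord i; lia.
  by exists (Ordinal i_n); exact/val_inj.
have mi : ord_max != i by rewrite ip eq_sym widen_neq_max.
rewrite -(ca ord_max)// -(cb ord_max)// -(ract_linearl (c ord_max)).
congr ract; apply: (mF p); rewrite /args_init -?ip//.
  by move=> q qp; rewrite ca// ip -val_eqE.
by move=> q qp; rewrite cb// ip -val_eqE.
Qed.

Lemma prod_merge (j : 'I_n) a :
  \prod_(i < n) `|args_merge j a i| <= \prod_(i < n.+1) `|a i|.
Proof.
rewrite (bigD1_ord (widen_ord (leqnSn n) j))//= (bigD1 j)//= [X in _ <= _ * X](bigD1 j)//=.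
rewrite {1}/args_merge ltnn eqxx mulrA.
have -> : lift (widen_ord (leqnSn n) j) j = lift ord0 j.
  by apply/val_inj; rewrite /= /bump leqnn.
rewrite [leRHS](_ : _ = `|a (widen_ord (leqnSn n) j)| * `|a (lift ord0 j)| *
    \prod_(i < n | i != j) `|args_merge j a i|); last first.
  congr (_ * _); apply: eq_bigr => i ij; rewrite /args_merge (negPf ij).
  move: ij; rewrite -val_eqE/= => ij.
  by case: ltnP => /= h; congr (Num.norm (a _)); apply/val_inj; rewrite /= /bump; lia.
by rewrite ler_wpM2r ?prodr_ge0// ler_norm_bmul.
Qed.

Lemma coboundary_subproof (F : cochain n) :
  coboundary_fun F \in @cochain_pred n.+1.
Proof.
have [mF [C0 /mbounded_norm bF]] := cochainP F; set C := `|C0| in bF.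
have pred3 (f g h : ('I_n.+1 -> A) -> M) : f \in @cochain_pred n.+1 ->
    g \in @cochain_pred n.+1 -> h \in @cochain_pred n.+1 ->
    (f + g) + (-1) ^+ n.+1 *: h \in @cochain_pred n.+1.
  by move=> fP gP hP; rewrite rpredD ?rpredZ// rpredD.
pose tl a := lact (a ord0) (F (args_tail a)).
pose mg j a := F (args_merge j a).
pose il a := ract (F (args_init a)) (a ord_max).
have -> : coboundary_fun F =
    tl + (\sum_(j < n) (-1) ^+ j.+1 *: mg j) + (-1) ^+ n.+1 *: il.
  apply/funext => a; rewrite /coboundary_fun [in RHS]fct_sumE.
  by [].
apply: pred3.
- apply/cochain_predP; split; first exact: multilinear_tail.
  have [D hD] := @lact_bounded _ _ M; exists (`|D| * C) => a.
  apply: (@le_trans _ _ (`|D| * `|a ord0| * `|F (args_tail a)|)).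
    have h := hD (a ord0) (F (args_tail a)); move: (h); rewrite -mulrA => h'.
    rewrite -mulrA -[X in _ <= _ * X]ger0_norm ?mulr_ge0// -normrM ger0_norm//.
    exact: le_trans h'.
  by rewrite big_ord_recl/= mulrACA ler_wpM2l ?mulr_ge0.
- apply: rpred_sum => j _; apply: rpredZ; apply/cochain_predP; split.
    exact: multilinear_merge.
  exists C => a; apply: le_trans (bF _) _.
  by apply: ler_wpM2l (prod_merge j a); exact: normr_ge0.
- apply/cochain_predP; split; first exact: multilinear_init.
  have [D hD] := @ract_bounded _ _ M; exists (`|D| * C) => a.
  apply: (@le_trans _ _ (`|D| * `|F (args_init a)| * `|a ord_max|)).
    have h := hD (F (args_init a)) (a ord_max); move: (h); rewrite -mulrA => h'.
    rewrite -mulrA -[X in _ <= _ * X]ger0_norm ?mulr_ge0// -normrM ger0_norm//.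
    exact: le_trans h'.
  by rewrite big_ord_recr/= [leRHS]mulrA ler_wpM2r// -[leRHS]mulrA ler_wpM2l.
Qed.

Definition coboundary (F : cochain n) : cochain n.+1 :=
  Cochain (coboundary_subproof F).

Lemma coboundary_linear : linear coboundary.
Proof.
move=> k F G; apply/val_inj/funext => a.
change (coboundary_fun (k *: (F : _ -> M) + (G : _ -> M)) a =
  k *: coboundary_fun F a + coboundary_fun G a).
rewrite /coboundary_fun.
change (lact (a ord0) (k *: F (args_tail a) + G (args_tail a)) +
 \sum_(j < n) (-1) ^+ j.+1 *: (k *: F (args_merge j a) + G (args_merge j a)) +
 (-1) ^+ n.+1 *: ract (k *: F (args_init a) + G (args_init a)) (a ord_max) =
 k *:
 (lact (a ord0) (F (args_tail a)) +
  \sum_(j < n) (-1) ^+ j.+1 *: F (args_merge j a) +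
  (-1) ^+ n.+1 *: ract (F (args_init a)) (a ord_max)) +
 (lact (a ord0) (G (args_tail a)) +
  \sum_(j < n) (-1) ^+ j.+1 *: G (args_merge j a) +
  (-1) ^+ n.+1 *: ract (G (args_init a)) (a ord_max))).
have /= -> := lact_linearr (a ord0) k (F (args_tail a)) (G (args_tail a)).
have /= -> := ract_linearl (a ord_max) k (F (args_init a)) (G (args_init a)).
under eq_bigr do rewrite scalerDr scalerA mulrC -scalerA.
rewrite big_split/= -scaler_sumr !scalerDr [_ *: (k *: ract _ _)]scalerA.
by rewrite [_ * k]mulrC -scalerA [X in X + _ = _]addrACA [LHS]addrACA.
Qed.

HB.instance Definition _ :=
  GRing.isLinear.Build _ _ _ _ coboundary coboundary_linear.

End Coboundary.

Section Cohomology.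
Variable n : nat.

Definition cocycle_pred : {pred cochain n} := [pred F | coboundary F == 0].

Lemma cocycle_submod : GRing.submod_closed cocycle_pred.
Proof.
split=> [|k F G]; first by apply/eqP; exact: linear0.
move=> /eqP F0 /eqP G0; apply/eqP.
by rewrite linearP/= F0 G0 scaler0 addr0.
Qed.

HB.instance Definition _ :=
  GRing.isSubmodClosed.Build _ _ cocycle_pred cocycle_submod.

Record cocycle := Cocycle { cocycle_val :> cochain n;
                            _ : cocycle_val \in cocycle_pred }.

HB.instance Definition _ := [isSub for cocycle_val].
HB.instance Definition _ := [Choice of cocycle by <:].
HB.instance Definition _ := [SubChoice_isSubLmodule of cocycle by <:].

End Cohomology.

(* The image of the coboundary map into degree n, with delta_(-1) = 0. *)
Definition im_coboundary n : set (cochain n) :=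
  if n is m.+1 then range (@coboundary m) else [set 0].

(* The image, as a subspace of the cocycles. *)
Definition coboundary_pred n : {pred cocycle n} :=
  [pred z : cocycle n | `[< im_coboundary z >]].

Lemma coboundary_submod n : GRing.submod_closed (@coboundary_pred n).
Proof.
split=> [|k y z]; first by apply/asboolP; case: n => //= m; exists 0; rewrite ?linear0.
move=> /asboolP hy /asboolP hz; apply/asboolP; case: n y z hy hz => /= [y z -> ->|m y z].
  by rewrite scaler0 addr0.
by move=> [F _ Fy] [G _ Gz]; exists (k *: F + G) => //; rewrite linearP/= Fy Gz.
Qed.

HB.instance Definition _ n := GRing.isSubmodClosed.Build _ _
  (@coboundary_pred n) (@coboundary_submod n).

Definition hochschild n := Quotient.quot (@coboundary_pred n).

HB.instance Definition _ n := GRing.Zmodule.on (hochschild n).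

End Hochschild.

Definition semilattice (S : semigroupType) : Prop :=
  commutative (fun s t : S => s * t)%g /\ forall s : S, (s * s)%g = s.

(* Main.v *)
Require Import Defs.
From mathcomp Require Import all_boot all_order all_algebra.
From mathcomp Require Import all_classical all_reals all_analysis.
From mathcomp Require Import complex.
From mathcomp Require Import summability.
From Stdlib Require List.
Set Implicit Arguments.
Unset Strict Implicit.
Unset Printing Implicit Defensive.
Import Order.TTheory GRing.Theory Num.Theory.
Import numFieldNormedType.Exports Normc.
Local Open Scope ring_scope.

(** A bounded n-cochain on l^1(S) is determined by its values on tuples of
basis vectors, that is, by a bounded function F from S^n to M, and every
bounded function arises; so the claim is that a bounded cocycle F on S^(n+1)
is the coboundary of a bounded G on S^n. Each e_s acts on M as one of a
family of commuting idempotents. Adjoin a unit 1 to S: this leaves cohomology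
unchanged, a cocycle being extended by zero to tuples that contain 1.

For a fixed finite set a = (a_1, ..., a_n), the algebra spanned by the products
of the a_i has the separability idempotent
  E_a = prod_i (a_i (x) a_i + (1 - a_i) (x) (1 - a_i)) = sum_k c_k y_k (x) z_k,
and H_a F (b) = sum_k c_k y_k F(z_k, b) satisfies H_a d F = F - d H_a F on
tuples b of elements of this algebra. The norm of E_a is bounded in terms of n
only, but grows with n, so that these elements do not yield one E for all of S
when S is infinite. But in degree n only n arguments occur, so a may vary with
the arguments. Put s_0 = 0 and
  (s_(n+1) F)(a) = ((1 - d s_n) (H_a F))(a).
The values of s_n F at a only involve F at products of the a_i, so the formula
for H_a d F may be used inside, and, d s_n being the identity on coboundaries
by induction,
  s_(n+1) d F (a) = ((1 - d s_n) (F - d H_a F))(a) = ((1 - d s_n) F)(a).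
Thus d s + s d = 1 in positive degrees, with norms bounded in terms of n and of
a bound for the action on M, and a cocycle F equals d (s F). This is the acyclic-models argument for functors on
semilattices, with the free semilattice on n generators as model.

The algebraic core is [contraction_delta], its quantitative form over a
semilattice without unit is [bounded_primitive], and the passage between
functions on S^n and cochains on l^1(S) is [multilinear_ext_cochain] (existence)
and [cochain_dirac0] (uniqueness). *)

(** * Deciding linear identities in abelian groups *)

(** An expression built from 0, addition and opposite is an integer combination
of its atoms, so two expressions with the same integer coefficients agree. *)
Section ZmodReflection.
Variable V : zmodType.

Inductive zexp := ZVar of nat | ZZero | ZAdd of zexp & zexp | ZOpp of zexp.

Fixpoint zeval (env : seq V) t : V :=
  match t with
  | ZVar i => env`_i
  | ZZero => 0
  | ZAdd t1 t2 => zeval env t1 + zeval env t2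
  | ZOpp t1 => - zeval env t1
  end.

Fixpoint zcoef t (i : nat) : int :=
  match t with
  | ZVar j => (i == j)%:Z
  | ZZero => 0
  | ZAdd t1 t2 => zcoef t1 i + zcoef t2 i
  | ZOpp t1 => - zcoef t1 i
  end.

Lemma zevalE env t : zeval env t = \sum_(i < size env) env`_i *~ zcoef t i.
Proof.
elim: t => [j| |t1 IH1 t2 IH2|t IH] /=.
- have [jn|nj] := ltnP j (size env).
    rewrite (bigD1 (Ordinal jn))//= eqxx mulr1z big1 ?addr0// => i.
    by rewrite -val_eqE/= => /negPf ->; rewrite mulr0z.
  rewrite nth_default// big1// => i _.
  by rewrite ltn_eqF ?mulr0z// (leq_trans (ltn_ord i)).
- by rewrite big1// => i _; rewrite mulr0z.
- by rewrite IH1 IH2 -big_split/=; apply: eq_bigr => i _; rewrite mulrzDr.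
- by rewrite IH -sumrN; apply: eq_bigr => i _; rewrite mulrNz.
Qed.

Lemma zeval_eq env t1 t2 :
  all (fun i => zcoef t1 i == zcoef t2 i) (iota 0 (size env)) ->
  zeval env t1 = zeval env t2.
Proof.
move=> /allP h; rewrite !zevalE; apply: eq_bigr => i _.
by rewrite (eqP (h _ _))// mem_iota add0n ltn_ord.
Qed.
End ZmodReflection.

Ltac zmod_atom x env :=
  lazymatch env with
  | nil => constr:(cons x nil)
  | cons x _ => env
  | cons ?y ?e => let e' := zmod_atom x e in constr:(cons y e')
  end.
Ltac zmod_atoms t env :=
  lazymatch t with
  | GRing.add ?x ?y => let e := zmod_atoms x env in zmod_atoms y e
  | GRing.opp ?x => zmod_atoms x env
  | GRing.zero => env
  | _ => zmod_atom t env
  end.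
Ltac zmod_index x env :=
  lazymatch env with
  | cons x _ => constr:(0%N)
  | cons _ ?e => let n := zmod_index x e in constr:(S n)
  end.
Ltac zmod_reify t env :=
  lazymatch t with
  | GRing.add ?x ?y => let a := zmod_reify x env in
      let b := zmod_reify y env in constr:(ZAdd a b)
  | GRing.opp ?x => let a := zmod_reify x env in constr:(ZOpp a)
  | GRing.zero => constr:(ZZero)
  | _ => let n := zmod_index t env in constr:(ZVar n)
  end.

(** Proves an equation between two such expressions. Atoms are compared
syntactically. *)
Ltac zmod :=
  lazymatch goal with
  | |- @eq ?V ?x ?y =>
    let e0 := zmod_atoms x (@nil V) in let env := zmod_atoms y e0 in
    let a := zmod_reify x env in let b := zmod_reify y env in
    refine (@zeval_eq _ env a b _); exact (erefl true)
  end.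

(** * The coboundary on functions of lists *)

(** Cochains of all degrees are handled together as functions on lists, the
degree being the length of the argument. *)
Section Delta.
Variables (T : Type) (mul : T -> T -> T) (V : zmodType) (act : T -> V -> V).
Implicit Types (F G : seq T -> V) (l : seq T).

(** The Hochschild coboundary for symmetric coefficients: after the two terms
a.F(b, ...) and F(ab, ...), what remains is minus the coboundary of F(a, -)
without its first term b.F(a, ...), which is therefore added back. In degree 0
the coboundary vanishes by symmetry. *)
Fixpoint delta F l : V :=
  if l is a :: l' then
    if l' is b :: l'' then
      act a (F l') - F (mul a b :: l'') + act b (F (a :: l''))
      - delta (fun t => F (a :: t)) l'
    else 0
  else 0.

Arguments delta : simpl never.

Lemma delta1 F a : delta F [:: a] = 0.
Proof. by []. Qed.

Lemma delta_cons F a b l : delta F (a :: b :: l) =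
  act a (F (b :: l)) - F (mul a b :: l) + act b (F (a :: l))
  - delta (fun t => F (a :: t)) (b :: l).
Proof. by []. Qed.

(** Needed because the homotopy identities below hold on a subsemigroup only. *)
Lemma delta_local (Q : T -> Prop) F G n :
  (forall a b, Q a -> Q b -> Q (mul a b)) ->
  (forall l, size l = n -> List.Forall Q l -> F l = G l) ->
  forall l, size l = n.+1 -> List.Forall Q l -> delta F l = delta G l.
Proof.
move=> QM; elim: n F G => [|n IH] F G FG [|a [|b l]] // [sl] /List.Forall_cons_iff[Qa].
move=> /List.Forall_cons_iff[Qb Ql]; rewrite !delta_cons.
congr (act _ _ - _ + act _ _ - _).
- by apply: FG => //=; [rewrite sl|constructor].
- by apply: FG => //=; [rewrite sl|constructor => //; exact: QM].
- by apply: FG => //=; [rewrite sl|constructor].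
- apply: IH => //=; [|by rewrite sl|by constructor].
  by move=> t st Qt; apply: FG => //=; [rewrite st|constructor].
Qed.

Lemma eq_delta_size F G n : (forall l, size l = n -> F l = G l) ->
  forall l, size l = n.+1 -> delta F l = delta G l.
Proof.
move=> FG l sl; apply: (@delta_local (fun=> True) _ _ n) => //.
  by move=> t ? _; exact: FG.
by elim: {sl} l => [|a l IH]; constructor.
Qed.

Lemma eq_delta F G l : F =1 G -> delta F l = delta G l.
Proof.
by move=> FG; case: l => // a l; apply: (@eq_delta_size _ _ (size l)) => // t _.
Qed.

Hypothesis act_sub : forall a, {morph act a : x y / x - y}.

Lemma act0 a : act a 0 = 0.
Proof. by rewrite -{1}[0](subrr 0) act_sub subrr. Qed.

Lemma actN a x : act a (- x) = - act a x.
Proof. by rewrite -[- x]sub0r act_sub act0 sub0r. Qed.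

Lemma actD a x y : act a (x + y) = act a x + act a y.
Proof. by rewrite -{1}[y]opprK act_sub actN opprK. Qed.

Lemma deltaB F G l : delta (fun t => F t - G t) l = delta F l - delta G l.
Proof.
elim: l F G => [|a [|b l] IH] F G; rewrite ?subr0//.
by rewrite !delta_cons !act_sub IH; zmod.
Qed.

Lemma delta0 l : delta (fun=> 0) l = 0.
Proof.
elim: l => [|a [|b l] IH]//.
by rewrite !delta_cons !act0 IH; zmod.
Qed.

Lemma deltaN F l : delta (fun t => - F t) l = - delta F l.
Proof.
rewrite -[RHS]sub0r -(delta0 l) -deltaB.
by apply: eq_delta => t; rewrite sub0r.
Qed.

Lemma deltaD F G l : delta (fun t => F t + G t) l = delta F l + delta G l.
Proof.
rewrite -[X in _ + X]opprK -deltaN -deltaB.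
by apply: eq_delta => t; rewrite opprK.
Qed.

Hypothesis mulC : commutative mul.
Hypothesis mulA : associative mul.
Hypothesis actM : forall a b x, act a (act b x) = act (mul a b) x.

Lemma actC a b x : act a (act b x) = act b (act a x).
Proof. by rewrite !actM mulC. Qed.

Lemma delta_act a F l : delta (fun t => act a (F t)) l = act a (delta F l).
Proof.
elim: l F => [|b [|c l] IH] F; rewrite ?act0//.
by rewrite !delta_cons IH !(act_sub, actD) ![act a (act _ _)]actC; zmod.
Qed.

Lemma delta_delta F l : delta (delta F) l = 0.
Proof.
elim: l F => [|a [|b l] IH] F//.
rewrite delta_cons.
(* The recursion writes (delta F)(a, -) as a combination of four cochains, two of
   which are merge and hd; they are then treated one by one. *)
pose merge t := if t is c :: t' then F (mul a c :: t') else 0.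
pose hd t := if t is c :: t' then act c (F (a :: t')) else 0.
have -> : delta (fun t => delta F (a :: t)) (b :: l) =
    delta (fun t => act a (F t) - merge t + hd t - delta (fun t => F (a :: t)) t)
      (b :: l).
  by case: l {IH} => // c l; apply: (@eq_delta_size _ _ (size l).+1) => // -[].
rewrite !(deltaB, deltaD) IH delta_act subr0.
case: l {IH} => [|c l]; first by rewrite !delta1 !act0; zmod.
rewrite !delta_cons/=.
have -> : delta (fun t => act b (F (a :: t))) (c :: l) =
  act b (delta (fun t => F (a :: t)) (c :: l)) by rewrite delta_act.
rewrite !(act_sub, actD) !mulA.
rewrite [act c (act b _)]actC [act b (act a _)]actC !actM.
zmod.
Qed.

End Delta.
Arguments delta : simpl never.

(** * The separability idempotent of a finitely generated semilattice *)

Section Separability.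
Variables (T : Type) (mul : T -> T -> T) (one : T).
Hypotheses (mulC : commutative mul) (mulA : associative mul).
Hypotheses (mul1 : left_id one mul) (mulxx : idempotent_op mul).
Variable V : zmodType.
Implicit Types (G : T -> T -> V) (l : seq T).

(** A bilinear function on the semigroup algebra is given by its values G y z at
basis elements. This is the effect on it of x (x) x + (1 - x) (x) (1 - x),
written as 2 x (x) x - x (x) 1 - 1 (x) x + 1 (x) 1. *)
Definition sep_gen x G y z : V :=
  (G (mul x y) (mul x z) - G (mul x y) z) + (G (mul x y) (mul x z) - G y (mul x z))
  + G y z.

(** The value of G at the product of the above elements for x in l, which is the
separability idempotent of the algebra generated by l. *)
Fixpoint sep l G : V := if l is x :: l' then sep l' (sep_gen x G) else G one one.

Lemma eq_sep l G H : (forall y z, G y z = H y z) -> sep l G = sep l H.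
Proof.
elim: l G H => [|x l IH] G H GH /=; first exact: GH.
by apply: IH => y z; rewrite /sep_gen !GH.
Qed.

Lemma sep_local (Q : T -> Prop) : Q one -> (forall a b, Q a -> Q b -> Q (mul a b)) ->
  forall l G H, List.Forall Q l -> (forall y z, Q y -> Q z -> G y z = H y z) ->
  sep l G = sep l H.
Proof.
move=> Q1 QM; elim=> [|x l IH] G H; first by move=> _ GH; exact: GH.
move=> /List.Forall_cons_iff[Qx Ql] GH /=; apply: IH => // y z Qy Qz.
by rewrite /sep_gen !GH//; exact: QM.
Qed.

Lemma sepB l G H : sep l (fun y z => G y z - H y z) = sep l G - sep l H.
Proof.
elim: l G H => [|x l IH] G H//=; rewrite -IH.
by apply: eq_sep => y z; rewrite /sep_gen; zmod.
Qed.

Lemma sep0 l : sep l (fun _ _ => 0) = 0.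
Proof.
rewrite -[RHS](subrr (sep l (fun _ _ => 0))) -sepB.
by apply: eq_sep => y z; rewrite subr0.
Qed.

Lemma sepD l G H : sep l (fun y z => G y z + H y z) = sep l G + sep l H.
Proof.
rewrite -[sep l H]opprK -[- sep l H]add0r -(sep0 l) -!sepB.
by apply: eq_sep => y z; zmod.
Qed.

(** Multiplication maps each factor x (x) x + (1 - x) (x) (1 - x) to
x + (1 - x) = 1. *)
Lemma sep_mul l (g : T -> V) : sep l (fun y z => g (mul y z)) = g one.
Proof.
elim: l => [|x l IH] /=; first by rewrite mul1.
rewrite -[RHS]IH; apply: eq_sep => y z; rewrite /sep_gen.
have -> : mul (mul x y) (mul x z) = mul x (mul y z).
  by rewrite (mulC x y) -mulA (mulA x x) mulxx mulA (mulC y) mulA.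
by rewrite -(mulA x y z) (mulA y x z) (mulC y x) -mulA; zmod.
Qed.

(** The identity w.E = E.w for the separability idempotent E of l, tested on all
bilinear functions G. *)
Definition central l w := forall G,
  sep l (fun y z => G (mul w y) z) = sep l (fun y z => G y (mul w z)).

Lemma central1 l : central l one.
Proof. by move=> G; apply: eq_sep => y z; rewrite !mul1. Qed.

Lemma centralM l a b : central l a -> central l b -> central l (mul a b).
Proof.
move=> la lb G.
transitivity (sep l (fun y z => G (mul a (mul b y)) z)).
  by apply: eq_sep => y z; rewrite mulA.
rewrite (lb (fun y z => G (mul a y) z)) (la (fun y z => G y (mul b z))).
by apply: eq_sep => y z; rewrite mulA (mulC b).
Qed.

(** Multiplying the factor of x by x (x) 1 or by 1 (x) x gives x (x) x, and the
other factors commute with both. *)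
Lemma central_gens l : List.Forall (central l) l.
Proof.
have mulCA x y z : mul x (mul y z) = mul y (mul x z) by rewrite mulA (mulC x) -mulA.
elim: l => [|x l IH]; constructor.
  move=> G /=; apply: eq_sep => y z; rewrite /sep_gen.
  by rewrite !(mulA x x) mulxx; zmod.
apply: List.Forall_impl IH => w lw G /=.
transitivity (sep l (fun y z => sep_gen x G (mul w y) z)).
  by apply: eq_sep => y z; rewrite /sep_gen !(mulCA w).
rewrite (lw (sep_gen x G)).
by apply: eq_sep => y z; rewrite /sep_gen !(mulCA w).
Qed.

End Separability.

(** * The contracting homotopy *)

Section Homotopy.
Variables (T : Type) (mul : T -> T -> T) (one : T).
Hypotheses (mulC : commutative mul) (mulA : associative mul).
Hypotheses (mul1 : left_id one mul) (mulxx : idempotent_op mul).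
Variables (V : zmodType) (act : T -> V -> V).
Hypothesis act_sub : forall a, {morph act a : x y / x - y}.
Hypothesis actM : forall a b x, act a (act b x) = act (mul a b) x.
Hypothesis act1 : forall x, act one x = x.
Implicit Types (F G : seq T -> V) (l : seq T).
Local Notation sep := (sep mul one).
Local Notation delta := (delta mul act).

Definition sep_homotopy l F b := sep l (fun y z => act y (F (z :: b))).

(** [sep l] is an integer combination of evaluations, and delta is additive. *)
Lemma delta_sep l (G : seq T -> T -> T -> V) b :
  delta (fun t => sep l (G t)) b = sep l (fun y z => delta (fun t => G t y z) b).
Proof.
elim: l G => [|x l IH] G //=.
rewrite (IH (fun t => sep_gen mul x (G t))); apply: eq_sep => y z.
by rewrite /sep_gen !(deltaB, deltaD).
Qed.

(** The last difference is the obstruction to [sep_homotopy l] being a contracting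
homotopy; it vanishes when b is central for l. *)
Lemma sep_homotopy_delta l F b t : sep_homotopy l (delta F) (b :: t) =
  F (b :: t) - delta (sep_homotopy l F) (b :: t) +
  (sep l (fun y z => act (mul b y) (F (z :: t))) -
   sep l (fun y z => act y (F (mul b z :: t)))).
Proof.
rewrite /sep_homotopy delta_sep.
have {1}-> : F (b :: t) = sep l (fun y z => act (mul y z) (F (b :: t))).
  by rewrite (@sep_mul _ _ _ mulC mulA mul1 mulxx V l (fun w => act w (F (b :: t)))) act1.
rewrite -!sepB -sepD; apply: eq_sep => y z; rewrite delta_act// delta_cons.
by rewrite !(act_sub, actD act_sub) !actM (mulC y b) (mulC z b); zmod.
Qed.

(** The homotopy s that lowers degrees by one, as a function of F and of a list a
of length n: the separability idempotent used is that of the arguments a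
themselves, and subtracting the coboundary term corrects for its dependence
on them. *)
Fixpoint contraction n F a : V :=
  if n is m.+1 then
    sep_homotopy a F a - delta (contraction m (sep_homotopy a F)) a
  else 0.

(** This locality is what allows identities that hold only on the subsemilattice
generated by the arguments to be used inside [contraction]. *)
Lemma contraction_local (Q : T -> Prop) n F G :
  Q one -> (forall a b, Q a -> Q b -> Q (mul a b)) ->
  (forall l, size l = n.+1 -> List.Forall Q l -> F l = G l) ->
  forall a, size a = n -> List.Forall Q a -> contraction n F a = contraction n G a.
Proof.
move=> Q1 QM; elim: n F G => [|n IH] F G FG a sa Qa //=.
have FGa l : size l = n.+1 -> List.Forall Q l -> sep_homotopy a F l = sep_homotopy a G l.
  move=> sl Ql; apply: (sep_local (Q := Q)) => // y z Qy Qz.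
  by rewrite FG//=; [rewrite sl|constructor].
congr (_ - _); first exact: FGa.
by apply: (@delta_local _ _ _ _ Q _ _ n) => // l sl Ql; apply: IH.
Qed.

Lemma eq_contraction n F G : F =1 G -> contraction n F =1 contraction n G.
Proof.
elim: n F G => [|n IH] F G FG a //=.
have HFG : sep_homotopy a F =1 sep_homotopy a G 
  by move=> t; apply: eq_sep => y z; rewrite FG.
by rewrite HFG; congr (_ - _); apply: eq_delta; exact: IH.
Qed.

Lemma contractionB n F G a :
  contraction n (fun t => F t - G t) a = contraction n F a - contraction n G a.
Proof.
elim: n F G a => [|n IH] F G a /=; first by rewrite subr0.
have HB t : sep_homotopy a (fun t => F t - G t) t =
    sep_homotopy a F t - sep_homotopy a G t.
  by rewrite /sep_homotopy -sepB; apply: eq_sep => y z; rewrite act_sub.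
rewrite HB [X in _ - X](@eq_delta _ _ _ _ _
  (fun t => contraction n (sep_homotopy a F) t -
    contraction n (sep_homotopy a G) t)); last first.
  by move=> t; rewrite (eq_contraction n HB) IH.
by rewrite deltaB//; zmod.
Qed.

Lemma contraction0 n a : contraction n (fun=> 0) a = 0.
Proof.
rewrite -[RHS](subrr (contraction n (fun=> 0) a)) -contractionB.
by apply: eq_contraction => t; rewrite subr0.
Qed.

Lemma sep_homotopy_delta_central l F t : (0 < size t)%N ->
  List.Forall (central mul one V l) t ->
  sep_homotopy l (delta F) t = F t - delta (sep_homotopy l F) t.
Proof.
case: t => // b t _ /List.Forall_cons_iff[Qb _].
by rewrite sep_homotopy_delta (Qb (fun y z => act y (F (z :: t)))) subrr addr0.
Qed.

(** The induction uses the homotopy identity on the lists of elements central for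
a, which form a subsemilattice containing the entries of a. *)
Theorem contraction_delta n F a : size a = n.+1 ->
  contraction n.+1 (delta F) a = F a - delta (contraction n F) a.
Proof.
elim: n F a => [|n IH] F a sa; rewrite [LHS]/=.
  rewrite sep_homotopy_delta_central ?sa//; last exact: central_gens.
  by case: a sa => [|x [|y a]]// _; rewrite !delta1 !subr0.
rewrite -/(contraction n.+1 _) sep_homotopy_delta_central ?sa//;
  last exact: central_gens.
set P := sep_homotopy a F; pose Q := central mul one V a.
have QM x y : Q x -> Q y -> Q (mul x y) by exact: centralM.
have -> : delta (contraction n.+1 (sep_homotopy a (delta F))) a =
    delta (contraction n.+1 (fun t => F t - delta P t)) a.
  apply: (@delta_local _ _ _ _ Q _ _ n.+1) sa (@central_gens _ _ one mulC mulA mulxx V a) => //.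
  move=> t st Qt; apply: (contraction_local (Q := Q)) => //.
    exact: central1.
  by move=> u su Qu; apply: sep_homotopy_delta_central => //; rewrite su.
rewrite (eq_delta _ _ _ (contractionB n.+1 F (delta P))) deltaB//.
have -> : delta (contraction n.+1 (delta P)) a = delta P a.
  transitivity (delta (fun t => P t - delta (contraction n P) t) a).
    by apply: eq_delta_size sa => t st; exact: IH.
  by rewrite deltaB// delta_delta// subr0.
by zmod.
Qed.

Corollary primitive_of_cocycle n F :
  (forall l, size l = n.+2 -> delta F l = 0) ->
  forall l, size l = n.+1 -> F l = delta (contraction n F) l.
Proof.
move=> F0 l sl; apply/eqP; rewrite -subr_eq0 -contraction_delta//.
rewrite (@contraction_local (fun=> True) _ _ (fun=> 0))// ?contraction0//.
  by move=> t st _; exact: F0.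
by elim: {sl} l => [|x l IH]; constructor.
Qed.
End Homotopy.

(** * Uniform bounds *)

Section Bounds.
Variables (T : Type) (mul : T -> T -> T) (one : T).
Variables (K : numDomainType) (V : normedZmodType K) (act : T -> V -> V).
Variable k : K.
Hypotheses (k_ge0 : 0 <= k) (actK : forall a x, `|act a x| <= k * `|x|).
Local Notation sep := (sep mul one).
Local Notation delta := (delta mul act).
Local Notation contraction := (contraction mul one act).

Lemma delta_bounded n : exists2 c, 0 <= c & forall (F : seq T -> V) B,
  (forall l, size l = n -> `|F l| <= B) ->
  forall l, size l = n.+1 -> `|delta F l| <= c * B.
Proof.
elim: n => [|n [c c0 IH]].
  exists 0 => // F B _ [|a [|b l]] //.
  by rewrite delta1 normr0 mul0r.
exists (k + 1 + k + c); first by rewrite !addr_ge0.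
move=> F B FB [|a [|b l]]// [sl]; rewrite delta_cons !mulrDl.
have actFB x t : size t = n.+1 -> `|act x (F t)| <= k * B.
  by move=> st; apply: le_trans (actK _ _) _; rewrite ler_wpM2l// FB.
apply: le_trans (ler_normB _ _) _; apply: lerD; last first.
  by apply: IH => [t st|]; [apply: FB; rewrite /= st|rewrite /= sl].
apply: le_trans (ler_normD _ _) _; apply: lerD; last by rewrite actFB//= sl.
apply: le_trans (ler_normB _ _) _; rewrite mul1r.
apply: lerD; first by rewrite actFB//= sl.
by rewrite FB//= sl.
Qed.

Lemma sep_bounded l (G : T -> T -> V) B : (forall y z, `|G y z| <= B) ->
  `|sep l G| <= 5%:R ^+ size l * B.
Proof.
elim: l G B => [|x l IH] G B GB /=; first by rewrite mul1r.
rewrite exprSr -mulrA; apply: IH => y z; rewrite /sep_gen.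
have B2 a b a' b' : `|G a b - G a' b'| <= B + B.
  by apply: le_trans (ler_normB _ _) _; apply: lerD.
have -> : 5%:R * B = B + B + (B + B) + B.
  by rewrite mulr_natl !mulrS mulr0n; zmod.
apply: le_trans (ler_normD _ _) _; apply: lerD => //.
by apply: le_trans (ler_normD _ _) _; apply: lerD.
Qed.

Lemma contraction_bounded n : exists2 c, 0 <= c & forall (F : seq T -> V) B,
  (forall l, size l = n.+1 -> `|F l| <= B) ->
  forall a, size a = n -> `|contraction n F a| <= c * B.
Proof.
elim: n => [|n [c c0 IH]].
  by exists 0 => // F B _ a _; rewrite normr0 mul0r.
have [d d0 dB] := delta_bounded n.
exists (5%:R ^+ n.+1 * k + d * (c * (5%:R ^+ n.+1 * k))).
  by rewrite addr_ge0 ?mulr_ge0 ?exprn_ge0.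
move=> F B FB a sa /=; rewrite mulrDl -!mulrA.
have HB t : size t = n.+1 -> `|sep_homotopy mul one act a F t| <= 5%:R ^+ n.+1 * (k * B).
  move=> st; rewrite -sa; apply: sep_bounded => y z.
  by apply: le_trans (actK _ _) _; rewrite ler_wpM2l// FB//= st.
apply: le_trans (ler_normB _ _) _; apply: lerD; first exact: HB.
by apply: dB => // t st; exact: IH.
Qed.
End Bounds.

(** * Adjoining a unit *)

Lemma delta_nat (T T' : Type) (mul : T -> T -> T) (mul' : T' -> T' -> T')
    (V : zmodType) (act : T -> V -> V) (act' : T' -> V -> V) (phi : T -> T') :
  {morph phi : a b / mul a b >-> mul' a b} ->
  (forall a x, act' (phi a) x = act a x) ->
  forall F l, delta mul' act' F (map phi l) = delta mul act (F \o map phi) l.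
Proof.
move=> phiM phi_act F l; elim: l F => [|a [|b l] IH] F //.
rewrite !map_cons !delta_cons !phi_act -phiM -(map_cons phi b l).
by congr (_ - _); rewrite IH; apply: eq_delta.
Qed.

(** Cochains that vanish when some argument is the unit form a subcomplex: if an
argument is 1, the two terms that absorb it cancel and the others still contain
it. *)
Lemma delta_normalised (T : Type) (mul : T -> T -> T) (one : T)
    (V : zmodType) (act : T -> V -> V) (unit : pred T) :
  left_id one mul -> right_id one mul -> (forall x, act one x = x) ->
  (forall a, {morph act a : x y / x - y}) ->
  (forall a, unit a -> a = one) -> unit one ->
  forall F, (forall l, has unit l -> F l = 0) ->
  forall l, has unit l -> delta mul act F l = 0.
Proof.
move=> mul1 mulr1 act1 act_sub unitE unit1 F F0 l.
elim: l F F0 => [|a [|b l] IH] F F0 //.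
rewrite delta_cons.
have [ua _|ua /= bl] := boolP (unit a).
  rewrite (unitE _ ua) mul1 act1 (F0 (one :: l))/= ?unit1// act0//.
  rewrite (@eq_delta _ _ _ _ _ (fun=> 0)) => [|t]; last by rewrite F0//= unit1.
  by rewrite delta0//; zmod.
have {}bl : unit b || has unit l by move: bl; rewrite (negPf ua).
rewrite IH//; last by move=> t ut; rewrite F0//= ut orbT.
have [ub|ub] := boolP (unit b).
  by rewrite (unitE _ ub) mulr1 act1 [F (one :: l)]F0/= ?unit1// act0//; zmod.
move: bl; rewrite (negPf ub)/= => bl.
have F0l x : F (x :: l) = 0 by rewrite F0//= bl orbT.
by rewrite !F0l !(act0 act_sub); zmod.
Qed.

Section AdjoinUnit.
Variables (S : Type) (mul : S -> S -> S) (K : numDomainType) (V : normedZmodType K).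
Variable act : S -> V -> V.

Definition omul (x y : option S) : option S :=
  match x, y with
  | Some a, Some b => Some (mul a b)
  | None, _ => y
  | _, None => x
  end.

Definition oact (x : option S) (v : V) : V := if x is Some a then act a v else v.

Hypotheses (mulC : commutative mul) (mulA : associative mul) (mulxx : idempotent_op mul).
Hypothesis act_sub : forall a, {morph act a : x y / x - y}.
Hypothesis actM : forall a b x, act a (act b x) = act (mul a b) x.
Variable k : K.
Hypotheses (k_ge0 : 0 <= k) (actK : forall a x, `|act a x| <= k * `|x|).

(** Over the semilattice with unit adjoined, F is extended by zero to lists that
contain the unit, which keeps it a cocycle. *)
Theorem bounded_primitive n : exists2 c, 0 <= c &
  forall (F : seq S -> V) B, 0 <= B ->
    (forall l, size l = n.+1 -> `|F l| <= B) ->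
    (forall l, size l = n.+2 -> delta mul act F l = 0) ->
  exists G : seq S -> V, (forall l, size l = n -> `|G l| <= c * B) /\
    (forall l, size l = n.+1 -> F l = delta mul act G l).
Proof.
have omulC : commutative omul by move=> [a|] [b|] //=; rewrite mulC.
have omulA : associative omul by move=> [a|] [b|] [c|] //=; rewrite mulA.
have omul1 : left_id None omul by case.
have omulr1 : right_id None omul by case.
have omulxx : idempotent_op omul by case=> [a|]//=; rewrite mulxx.
have oact_sub a : {morph oact a : x y / x - y}.
  by case: a => [a|] x y //=; rewrite act_sub.
have oactM a b x : oact a (oact b x) = oact (omul a b) x.
  by case: a b => [a|] [b|] //=; rewrite actM.
have oactK a x : `|oact a x| <= (k + 1) * `|x|.
  rewrite mulrDl mul1r; case: a => [a|] /=; last by rewrite lerDr mulr_ge0.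
  by rewrite (le_trans (actK _ _))// lerDl.
have [|c c0 cB] := @contraction_bounded _ omul None _ _ oact (k + 1) _ oactK n.
  by rewrite addr_ge0.
exists c => // F B B0 FB dF.
pose F1 (l : seq (option S)) :=
  if has (fun x => ~~ isSome x) l then 0 else F (pmap (fun x : option S => x) l).
have F1E l : F1 (map Some l) = F l.
  rewrite /F1 has_map; have -> : has (preim Some (fun x => ~~ isSome x)) l = false.
    by elim: l.
  by congr F; elim: l => //= x l ->.
have listE (l : seq (option S)) : has (fun x => ~~ isSome x) l = false ->
    exists l', l = map Some l'.
  elim: l => [|[x|] l IH]//= => [_|/IH[l' ->]]; first by exists [::].
  by exists (x :: l').
have dS G l : delta omul oact G (map Some l) = delta mul act (G \o map Some) l.
  exact: delta_nat.
have dF1 l : size l = n.+2 -> delta omul oact F1 l = 0.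
  have [ul _|/negbTE/listE[l' ->]] := boolP (has (fun x => ~~ isSome x) l).
    by apply: (delta_normalised omul1 omulr1 _ oact_sub _ _ _ ul) => // [[]//|t];
      rewrite /F1 => ->.
  by rewrite size_map dS (eq_delta _ _ _ F1E); exact: dF.
exists (fun l => contraction omul None oact n F1 (map Some l)); split=> l sl.
  apply: cB; last by rewrite size_map.
  move=> t; rewrite /F1; case: ifPn => [_ _|/negbTE/listE[t' ->]].
    by rewrite normr0.
  by rewrite size_map => st; rewrite (_ : pmap _ _ = t') ?FB//;
    elim: t' {st} => //= x t' ->.
rewrite -F1E (primitive_of_cocycle omulC omulA omul1 omulxx oact_sub oactM _ dF1)
  ?size_map//.
Qed.
End AdjoinUnit.

(** * Bounded multilinear extension from basis vectors *)

Section L1Integral.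
Local Open Scope classical_set_scope.
Import finmap.
Variables (R : realType) (S : choiceType) (V : completeNormedModType R[i]).
#[local] Existing Instance totally_filter.
Local Notation l1 := (l1 R S).
Implicit Types (phi psi : S -> V) (a b : l1).

(** The bounded linear extension of phi to l^1(S). *)
Definition l1_int phi a : V := sum (fun s => a s *: phi s).

Lemma partial_sum_fset (x : S -> V) (A : {fset S}) :
  partial_sum x A = \sum_(i <- A) x i.
Proof. by rewrite /partial_sum big_seq_fsetE. Qed.

Lemma l1_int_cvg phi a (B : R[i]) : (forall s, `|phi s| <= B) ->
  partial_sum (fun s => a s *: phi s) @ totally --> l1_int phi a.
Proof.
move=> phiB.
suff : cvg (partial_sum (fun s => a s *: phi s) @ totally) by [].
apply: cauchy_cvg; apply: cauchy_exP => e e0.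
pose C : R := normc B + 1.
have C0 : 0 < C by rewrite ltr_wpDl// normc_ge0.
have phiC s : `|phi s| <= C%:C%C.
  apply: le_trans (phiB s) _; apply: le_trans (real_ler_norm _) _.
    by rewrite ger0_real// (le_trans _ (phiB s)).
  by rewrite normcE_C lecR lerDl.
have {e0}[r r0 ->] := ltC0E e0.
have aoo : (l1E (fun s => (normc (a s))%:C%C : R[i]) < +oo)%E.
  apply: le_lt_trans (l1P a); apply: le_esum => s _.
  rewrite lee_fin [leLHS](_ : _ = normc (a s))// /normc/= expr0n addr0.
  by rewrite sqrtr_sqr ger0_norm// normc_ge0.
have [|A hA] := @l1E_tail _ _ _ aoo (r / (C * 2)); first by rewrite divr_gt0// mulr_gt0.
exists (partial_sum (fun s => a s *: phi s) A); exists A => // D AD.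
rewrite -ball_normE /ball_/= !partial_sum_fset distrC.
(* Used in V for the tail to be bounded, and in R[i] for its bound. *)
have split (W : zmodType) (f : S -> W) :
    \sum_(i <- D) f i - \sum_(i <- A) f i = \sum_(i <- (D `\` A)%fset) f i.
  rewrite (big_fsetID _ (mem A) D)/=.
  have -> : [fset x | x in D & x \in A]%fset = A.
    apply/fsetP => x; rewrite !inE/=; apply/andP/idP => [[]//|xA].
    by split=> //; exact: (fsubsetP AD).
  have -> : [fset x | x in D & x \notin A]%fset = (D `\` A)%fset.
    by apply/fsetP => x; rewrite !inE/= andbC.
  by rewrite addrC addrK.
rewrite split; have := hA D AD; rewrite split => {}hA.
apply: le_lt_trans (ler_norm_sum _ _ _) _.
apply: (@le_lt_trans _ _ (\sum_(i <- (D `\` A)%fset) C%:C%C * (normc (a i))%:C%C)).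
  by apply: ler_sum => s _; rewrite normrZ mulrC ler_wpM2r.
rewrite -mulr_sumr.
have -> : \sum_(i <- (D `\` A)%fset) (normc (a i))%:C%C =
  (normc (\sum_(i <- (D `\` A)%fset) (normc (a i))%:C%C))%:C%C :> R[i].
  rewrite -normcE_C ger0_norm// sumr_ge0// => i _.
  by rewrite ler0c normc_ge0.
rewrite -rmorphM/= ltcR'; apply: (@le_lt_trans _ _ (C * (r / (C * 2)))).
  by rewrite ler_pM2l.
have -> : C * (r / (C * 2)) = r / 2 by rewrite invfM mulrCA mulVKf ?gt_eqF.
by rewrite ltr_pdivrMr// ltr_pMr// ltr1n.
Qed.

Lemma l1_int_unique phi a (v : V) :
  partial_sum (fun s => a s *: phi s) @ totally --> v -> l1_int phi a = v.
Proof. by move=> h; apply: cvg_lim h => //; exact: norm_hausdorff. Qed.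

Lemma l1_int_linear phi (B : R[i]) : (forall s, `|phi s| <= B) -> linear (l1_int phi).
Proof.
move=> phiB k a b; apply: l1_int_unique.
rewrite [X in X @ _](_ : _ = k \*: partial_sum (fun s => a s *: phi s)
    + partial_sum (fun s => b s *: phi s)).
  by apply: cvgD; [apply: cvgZl_tmp|]; exact: l1_int_cvg phiB.
apply/funext => A; rewrite [RHS](_ : _ = k *: partial_sum (fun s => a s *: phi s) A
  + partial_sum (fun s => b s *: phi s) A)// /partial_sum scaler_sumr -big_split.
by apply: eq_bigr => i _; rewrite /= scalerA -scalerDl.
Qed.

Lemma l1_int_linear_fun k phi psi (B C : R[i]) a :
  (forall s, `|phi s| <= B) -> (forall s, `|psi s| <= C) ->
  l1_int (fun s => k *: phi s + psi s) a = k *: l1_int phi a + l1_int psi a.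
Proof.
move=> phiB psiC; apply: l1_int_unique.
rewrite [X in X @ _](_ : _ = k \*: partial_sum (fun s => a s *: phi s)
    + partial_sum (fun s => a s *: psi s)).
  by apply: cvgD; [apply: cvgZl_tmp; exact: l1_int_cvg phiB|exact: l1_int_cvg psiC].
apply/funext => A; rewrite [RHS](_ : _ = k *: partial_sum (fun s => a s *: phi s) A
  + partial_sum (fun s => a s *: psi s) A)// /partial_sum scaler_sumr -big_split.
by apply: eq_bigr => i _; rewrite /= scalerDr !scalerA mulrC.
Qed.

Lemma l1_int_bounded phi (B : R[i]) a : 0 <= B -> (forall s, `|phi s| <= B) ->
  `|l1_int phi a| <= B * `|a|.
Proof.
move=> B0 phiB; apply/ler_addgt0Pr => e e0.
have /cvgrPdist_le/(_ e e0)[A _ /(_ A)] := l1_int_cvg (a := a) phiB.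
rewrite /= fsubset_refl => /(_ isT) h.
rewrite -[X in `|X|](subrK (partial_sum (fun s => a s *: phi s) A)) [leRHS]addrC.
apply: le_trans (ler_normD _ _) _; apply: lerD => //.
rewrite partial_sum_fset; apply: le_trans (ler_norm_sum _ _ _) _.
apply: (@le_trans _ _ (\sum_(i <- A) B * (normc (a i))%:C%C)).
  by apply: ler_sum => s _; rewrite normrZ mulrC ler_wpM2r.
rewrite -mulr_sumr ler_wpM2l// -rmorph_sum/= l1_normE lecR -lee_fin -l1E_norm.
by apply: esum_geE => i; exact: normc_ge0.
Qed.

Lemma l1_int_dirac phi s : l1_int phi (l1_dirac R s) = phi s.
Proof.
apply: l1_int_unique; apply/cvgrPdist_le => e e0.
exists [fset s]%fset => // D; rewrite /= fsub1set => sD.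
rewrite partial_sum_fset (big_fsetD1 s)//= eqxx scale1r big_seq.
rewrite big1 ?addr0 ?subrr ?normr0 ?ltW// => i.
by rewrite !inE => /andP[/negPf is_ _]; rewrite is_ scale0r.
Qed.

End L1Integral.

(** * Tuples of arguments as lists *)

Section OrdSeq.
Variables (X : Type).

Definition ord_seq n (a : 'I_n -> X) : seq X := [seq a i | i <- enum 'I_n].

Lemma size_ord_seq n (a : 'I_n -> X) : size (ord_seq a) = n.
Proof. by rewrite size_map size_enum_ord. Qed.

Lemma ord_seq_recl n (a : 'I_n.+1 -> X) :
  ord_seq a = a ord0 :: ord_seq (fun i => a (lift ord0 i)).
Proof. by rewrite /ord_seq enum_ordSl /= -map_comp. Qed.

Lemma ord_seq0 (a : 'I_0 -> X) : ord_seq a = [::].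
Proof. by apply: size0nil; rewrite size_ord_seq. Qed.

Lemma nth_ord_seq x0 n (a : 'I_n -> X) (i : 'I_n) : nth x0 (ord_seq a) i = a i.
Proof. by rewrite (nth_map i) ?size_enum_ord// nth_ord_enum. Qed.

Lemma ord_seq_nth x0 n (l : seq X) : size l = n ->
  ord_seq (fun i : 'I_n => nth x0 l i) = l.
Proof.
move=> sl; apply: (@eq_from_nth _ x0); rewrite size_ord_seq// => i i_n.
by rewrite (nth_ord_seq x0 _ (Ordinal i_n)).
Qed.

Lemma eq_ord_seq n (a b : 'I_n -> X) : a =1 b -> ord_seq a = ord_seq b.
Proof. by move=> ab; apply: eq_map. Qed.
End OrdSeq.

Lemma map_ord_seq (X Y : Type) (f : X -> Y) n (a : 'I_n -> X) :
  map f (ord_seq a) = ord_seq (f \o a).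
Proof. by rewrite /ord_seq -map_comp. Qed.

Section CoboundaryDelta.
Variables (K : numFieldType) (A : banachAlgType K) (M : banachBimodType A).
Hypothesis symM : symmetric_bimod M.

Lemma coboundary_fun_delta n (F : seq A -> M) (a : 'I_n.+1 -> A) :
  coboundary_fun (fun b : 'I_n -> A => F (ord_seq b)) a =
  delta bmul lact F (ord_seq a).
Proof.
elim: n F a => [|n IH] F a; rewrite /coboundary_fun.
  rewrite big_ord0 addr0 !ord_seq_recl !ord_seq0 delta1 expr1 scaleN1r -symM.
  by rewrite (_ : ord_max = ord0) ?subrr//; exact/val_inj.
have initE : ord_seq (args_init a) = a ord0 :: ord_seq (args_init (args_tail a)).
  rewrite ord_seq_recl; congr (a _ :: _); first exact/val_inj.
  by apply: eq_ord_seq => i; congr a; exact/val_inj.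
have merge0E : ord_seq (args_merge ord0 a) =
    bmul (a ord0) (a (lift ord0 ord0)) :: ord_seq (args_tail (args_tail a)).
  rewrite ord_seq_recl; congr (_ :: _).
    by rewrite /args_merge ltnn eqxx; congr (bmul (a _) (a _)); exact/val_inj.
have mergeSE (j : 'I_n) : ord_seq (args_merge (lift ord0 j) a) =
    a ord0 :: ord_seq (args_merge j (args_tail a)).
  rewrite ord_seq_recl; congr (_ :: _).
    by rewrite /args_merge/=; congr a; exact/val_inj.
  apply: eq_ord_seq => i; rewrite /args_merge/= /args_tail.
  rewrite [in X in if X then _ else _]/bump !leq0n !add1n ltnS.
  rewrite (inj_eq lift_inj).
  case: ifP => _; first by congr a; exact/val_inj.
  by case: ifP => _ //; congr (bmul (a _) (a _)); exact/val_inj.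
have tail2E :
    args_tail a ord0 :: ord_seq (args_tail (args_tail a)) = ord_seq (args_tail a).
  by rewrite [RHS]ord_seq_recl.
have -> : ord_seq a =
    a ord0 :: args_tail a ord0 :: ord_seq (args_tail (args_tail a)).
  by rewrite tail2E ord_seq_recl.
rewrite delta_cons tail2E -IH.
rewrite /coboundary_fun big_ord_recl merge0E expr1 scaleN1r initE.
under eq_bigr do rewrite mergeSE exprS mulN1r scaleNr.
rewrite sumrN [(-1) ^+ n.+2]exprS mulN1r scaleNr -symM -symM.
have -> : args_tail a ord_max = a ord_max by congr a; exact/val_inj.
rewrite -[a (lift ord0 ord0)]/(args_tail a ord0).
rewrite [X in - _ - X](_ : _ = \sum_(j < n)
  (-1) ^+ j.+1 *: F (a ord0 :: ord_seq (args_merge j (args_tail a)))) //.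
set u := (X in _ - X = _); set v := (X in _ = _ - (_ + X)).
by have -> : u = v by []; zmod.
Qed.

End CoboundaryDelta.

(** * From functions on S^n to cochains on l^1(S) *)

Section MultilinearExtension.
Variables (R : realType) (S : semigroupType) (M : banachBimodType (l1 R S)).
Local Notation l1 := (l1 R S).
Implicit Types (G : seq S -> M) (l : seq l1).

Fixpoint multilinear_ext G l : M :=
  if l is a :: l' then l1_int (fun s => multilinear_ext (fun t => G (s :: t)) l') a
  else G [::].

Lemma multilinear_ext_bounded n G (B : R[i]) : 0 <= B ->
  (forall t, size t = n -> `|G t| <= B) ->
  forall l, size l = n -> `|multilinear_ext G l| <= B * \prod_(a <- l) `|a|.
Proof.
move=> B0; elim: n G => [|n IH] G GB [|a l] //= sl.
  by rewrite big_nil mulr1 GB.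
rewrite big_cons mulrCA mulrC; apply: l1_int_bounded => [|s].
  by rewrite mulr_ge0// prodr_ge0.
by apply: IH => [t st|]; [rewrite GB//= st|case: sl].
Qed.

Lemma multilinear_ext_dirac G t : multilinear_ext G (map (@l1_dirac R S) t) = G t.
Proof.
elim: t G => [|s t IH] G //=.
by rewrite l1_int_dirac IH.
Qed.

Lemma multilinear_ext_multilinear n G (B : R[i]) : 0 <= B ->
  (forall t, size t = n -> `|G t| <= B) ->
  multilinear (fun a : 'I_n -> l1 => multilinear_ext G (ord_seq a)).
Proof.
move=> B0 GB; apply/multilinearP; elim: n G GB => [|n IH] G GB i k a b c.
  by case: i.
move=> ca cb ci; rewrite !ord_seq_recl /=.
have GsB s t : size t = n -> `|G (s :: t)| <= B by move=> st; rewrite GB//= st.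
have tB (d : 'I_n -> l1) s : `|multilinear_ext (fun t => G (s :: t)) (ord_seq d)| <=
    B * \prod_(a <- ord_seq d) `|a|.
  by apply: (multilinear_ext_bounded B0 (GsB s)); rewrite size_ord_seq.
case: (unliftP ord0 i) => [p|] ip.
  rewrite -(ca ord0) ?ip// -(cb ord0) ?ip//.
  rewrite -(l1_int_linear_fun _ _ (tB _) (tB _)).
  congr l1_int; apply/funext => s; apply: (IH _ (GsB s) p); rewrite -?ip//.
    by move=> q qp; rewrite ca// ip (inj_eq lift_inj).
  by move=> q qp; rewrite cb// ip (inj_eq lift_inj).
have -> : ord_seq (fun j => a (lift ord0 j)) = ord_seq (fun j => c (lift ord0 j)).
  by apply: eq_ord_seq => j; rewrite ca// ip.
have -> : ord_seq (fun j => b (lift ord0 j)) = ord_seq (fun j => c (lift ord0 j)).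
  by apply: eq_ord_seq => j; rewrite cb// ip.
by rewrite -ip ci (l1_int_linear (tB _)).
Qed.

Lemma multilinear_ext_cochain n G (B : R[i]) : 0 <= B ->
  (forall t, size t = n -> `|G t| <= B) ->
  (fun a : 'I_n -> l1 => multilinear_ext G (ord_seq a)) \in @cochain_pred _ _ M n.
Proof.
move=> B0 GB; apply/cochain_predP; split; first exact: multilinear_ext_multilinear GB.
exists B => a; rewrite (le_trans (multilinear_ext_bounded B0 GB _)) ?size_ord_seq//.
by rewrite /ord_seq big_map big_enum.
Qed.

(** The arguments are replaced by arbitrary elements of l^1(S) one at a time, each
step being the density of the linear span of the basis vectors. *)
Lemma cochain_dirac0 n (F : cochain M n) :
  (forall s : 'I_n -> S, F (fun i => l1_dirac R (s i)) = 0) -> F = 0.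
Proof.
move=> F0; apply/val_inj/funext => a /=.
have [linF [C0 /mbounded_norm bF]] := cochainP F.
(* Induction on the number m of initial arguments that are arbitrary. *)
suff H m : forall a : 'I_n -> l1,
    (forall i : 'I_n, (m <= i)%N -> exists s, a i = l1_dirac R s) -> F a = 0.
  by apply: (H n) => i; rewrite leqNgt ltn_ord.
elim: m => [|m IH] {}a am.
  have [s sE] := choice (fun i => am i (leq0n i)).
  by have -> : a = fun i => l1_dirac R (s i) by exact/funext.
have [mn|nm] := ltnP m n; last first.
  by apply: IH => i mi; have := leq_ltn_trans (leq_trans nm mi) (ltn_ord i); rewrite ltnn.
pose i := Ordinal mn.
have -> : a = dfwith a i (a i).
  apply/funext => j; have [->|ji] := eqVneq j i.
    by rewrite dfwithin.
  by rewrite dfwithout// eq_sym.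
pose D : R[i] := `|C0| * \prod_(j < n | j != i) `|a j|.
have D0 : 0 <= D by rewrite mulr_ge0// prodr_ge0.
apply: (@l1_ext R S M (fun x => F (dfwith a i x)) (normc D)).
- exact: linF.
- move=> x; apply: le_trans (bF _) _.
  rewrite -normcE_C (ger0_norm D0) (bigD1 i)//= dfwithin mulrCA mulrC.
  rewrite ler_wpM2r// ler_wpM2l// le_eqVlt; apply/orP; left; apply/eqP.
  by apply: eq_bigr => j ji; rewrite dfwithout// eq_sym.
move=> s; apply: IH => j mj; have [->|ji] := eqVneq j i.
  by exists s; rewrite dfwithin.
rewrite dfwithout 1?eq_sym//; apply: am.
by rewrite ltn_neqAle mj andbT; move: ji; rewrite -val_eqE eq_sym.
Qed.

End MultilinearExtension.

Section DiracNorm.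
Import finmap.

Lemma l1_dirac_norm (R : realType) (S : choiceType) (s : S) :
  `|l1_dirac R s| <= 1.
Proof.
rewrite l1_normE -[1]/(1%:C%C) lecR -lee_fin -l1E_norm.
apply: esum_leE => A; rewrite lee_fin.
have [sA|sA] := boolP (s \in A).
  rewrite (big_fsetD1 s)//= eqxx normc1 big_seq big1 ?addr0// => i.
  by rewrite !inE => /andP[/negPf -> _]; rewrite normc0.
rewrite big_seq big1// => i iA; rewrite /=; case: eqP => [E|_]; last by rewrite normc0.
by rewrite -E iA in sA.
Qed.

End DiracNorm.

(** * Vanishing of cohomology *)

(** The restriction of z to basis vectors has a bounded primitive G on S^n, and
the multilinear extension of G is a primitive of z because both sides agree on
basis vectors. *)
Theorem symmetric_cocycle_is_coboundary (R : realType) (S : semigroupType)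
    (M : banachBimodType (l1 R S)) (n : nat) (z : cocycle M n.+1) :
  semilattice S -> symmetric_bimod M ->
  exists g : cochain M n, coboundary g = z.
Proof.
move=> [SC Sxx] hM.
pose D s := l1_dirac R (s : S); pose act s (v : M) := lact (D s) v.
have act_sub s : {morph act s : u v / u - v}.
  by move=> u v; rewrite /act addrC -scaleN1r lact_linearr scaleN1r addrC.
have DM : {morph D : s t / (s * t)%g >-> s ** t}.
  by move=> s t; exact: (esym (l1_mul_dirac R s t)).
have actM s t v : act s (act t v) = act (s * t)%g v by rewrite /act lactA DM.
have [k0 hk0] := @lact_bounded _ _ M.
have actK s v : `|act s v| <= `|k0| * `|v|.
  have h := hk0 (D s) v.
  have k0M : 0 <= k0 * `|D s| * `|v| by apply: le_trans h.
  apply: le_trans h _; rewrite -(ger0_norm k0M) !normrM !normr_id.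
  by rewrite ler_wpM2r// ler_piMr// l1_dirac_norm.
have [c c0 prim] :=
  bounded_primitive SC (@mulgA S) Sxx act_sub actM (normr_ge0 k0) actK n.
have [_ [B0 /mbounded_norm zB]] := cochainP z; set B := `|B0| in zB.
have B_ge0 : 0 <= B by exact: normr_ge0.
pose zl (a : seq (l1 R S)) : M := z (fun i => nth 0 a i).
have zlE (b : 'I_n.+1 -> l1 R S) : zl (ord_seq b) = z b.
  by rewrite /zl; congr (cochain_val z); apply/funext => i; rewrite nth_ord_seq.
pose F t := zl (map D t).
have [| |G [GB dG]] := prim F B B_ge0.
- move=> t st; rewrite /F /zl (le_trans (zB _))// ler_piMr//.
  apply: Num.Theory.prodr_ile1 => i _; rewrite normr_ge0/=.
  have /(all_nthP 0)/(_ i) : all (fun a : l1 R S => `|a| <= 1) (map D t).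
    by apply/allP => _ /mapP[s _ ->]; exact: l1_dirac_norm.
  by rewrite size_map st; exact.
- move=> t st.
  have <- : delta bmul lact zl (map D t) = delta (fun s t => (s * t)%g) act F t.
    exact: delta_nat.
  rewrite -(@ord_seq_nth _ 0 n.+2 (map D t)) ?size_map// -coboundary_fun_delta//.
  have /eqP/(congr1 val)/(congr1 (fun f =>
    f (fun i : 'I_n.+2 => nth 0 (map D t) i))) /= h := valP z.
  rewrite -[RHS]h; congr (coboundary_fun _ _); apply/funext => b; exact: zlE.
have cB0 : 0 <= c * B by rewrite mulr_ge0.
pose g : cochain M n := Cochain (multilinear_ext_cochain cB0 GB).
exists g; apply/eqP; rewrite -subr_eq0; apply/eqP; apply: cochain_dirac0 => s.
apply/eqP; rewrite subr_eq0; apply/eqP.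
transitivity (coboundary_fun
  (fun b : 'I_n -> l1 R S => multilinear_ext G (ord_seq b)) (fun i => D (s i))).
  by [].
rewrite coboundary_fun_delta// -(map_ord_seq D).
have -> : delta bmul lact (multilinear_ext G) (map D (ord_seq s)) =
    delta (fun s t => (s * t)%g) act (multilinear_ext G \o map D) (ord_seq s).
  exact: delta_nat.
rewrite (eq_delta _ _ _ (multilinear_ext_dirac G)) -dG ?size_ord_seq//.
by rewrite /F map_ord_seq zlE.
Qed.

Theorem corollary4p3 (R : realType) (S : semigroupType) (hS : semilattice S)
    (M : banachBimodType (l1 R S)) (hM : symmetric_bimod M)
    (n : nat) (hn : (1 <= n)%N) (x : hochschild M n) :
  x = 0.
Proof.
case: n hn x => // n _ x; rewrite -[x]reprK.
have [g gx] := symmetric_cocycle_is_coboundary (repr x) hS hM.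
have -> : 0 = \pi_(hochschild M n.+1)%qT 0 :> hochschild M n.+1 by rewrite piE.
apply/eqP; rewrite -Quotient.idealrBE subr0; apply/asboolP.
by exists g.
Qed.
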